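(* Let $k\ge 1$, let $T_i\in\mathrm{SL}(2,\mathbb{Z})$, $i=1,\ldots,k$, be unipotent elements, and let $a_{i,n}\in\mathbb{Z}$, $i=1,\ldots,k$, $n\ge 1$, be such that $$a_{1,n}\to\infty\quad\text{and}\quad \frac{a_{i+1,n}}{a_{i,n}}\to\infty,\ \ i=1,\ldots,k-1,\quad\text{as } n\to\infty.$$ Then the sequences $T_1^{a_{1,n}},\ldots,T_k^{a_{k,n}}$ are relatively jointly mixing.
   Context: $\mathbb{T}^2=\mathbb{R}^2/\mathbb{Z}^2$ is the 2-dimensional torus with normalized Haar (Lebesgue) measure $d\xi$; $\mathrm{SL}(2,\mathbb{Z})$ acts on $\mathbb{T}^2$ by automorphisms $\xi\mapsto T\xi$. A matrix is unipotent if all its eigenvalues are equal to $1$. For $T_i\in\mathrm{SL}(2,\mathbb{Z})$, let $P_i:L^2(\mathbb{T}^2)\to L^2(\mathbb{T}^2)$ be the orthogonal projection onto the subspace of $T_i$-invariant functions. For $a_{i,n}\in\mathbb{Z}$, the sequences $T_1^{a_{1,n}},\ldots,T_k^{a_{k,n}}$ are relatively jointly mixing if for all $f_1,\ldots,f_{k+1}\in L^\infty(\mathbb{T}^2)$, $$\int_{\mathbb{T}^2} f_1(T_1^{a_{1,n}}\xi)\cdots f_k(T_k^{a_{k,n}}\xi)f_{k+1}(\xi)\,d\xi\to \int_{\mathbb{T}^2}(P_1f_1)(\xi)\cdots (P_kf_k)(\xi)f_{k+1}(\xi)\,d\xi\quad\text{as } n\to\infty.$$ *)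

(* Defs.v *)
From HB Require Import structures.
From mathcomp Require Import all_boot all_order all_algebra complex.
From mathcomp Require Import generic_quotient.
From mathcomp Require Import all_classical all_reals all_analysis.

Set Implicit Arguments.
Unset Strict Implicit.
Unset Printing Implicit Defensive.
Import Order.TTheory GRing.Theory Num.Theory.
Import numFieldNormedType.Exports.

Local Open Scope classical_set_scope.
Local Open Scope ring_scope.
Local Open Scope quotient_scope.

Definition plane (R : realType) : Type :=
  (measurableTypeR R * measurableTypeR R)%type.

HB.instance Definition _ (R : realType) := Measurable.on (plane R).

Section torus.
Context {R : realType}.

(* congruence modulo Z^2 *)
Definition zequiv (x y : plane R) : bool :=
  ((x.1 - y.1 : R) \is a Num.int) && ((x.2 - y.2 : R) \is a Num.int).

Lemma zequiv_refl : reflexive zequiv.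
Proof. by move=> x; rewrite /zequiv !subrr rpred0. Qed.

Lemma zequiv_sym : symmetric zequiv.
Proof.
by move=> x y; rewrite /zequiv -rpredN opprB -[in X in _ && X]rpredN opprB.
Qed.

Lemma zequiv_trans : transitive zequiv.
Proof.
move=> y x z /andP[xy1 xy2] /andP[yz1 yz2]; apply/andP; split.
  by rewrite -(subrKA (y.1 : R)) rpredD.
by rewrite -(subrKA (y.2 : R)) rpredD.
Qed.

Canonical zequiv_equiv := EquivRel zequiv zequiv_refl zequiv_sym zequiv_trans.

End torus.

Definition torus (R : realType) : Type := {eq_quot (@zequiv R)}.

HB.instance Definition _ (R : realType) := Choice.on (torus R).
HB.instance Definition _ (R : realType) := EqQuotient.on (torus R).
HB.instance Definition _ (R : realType) :=
  isPointed.Build (torus R) (\pi_(torus R) ((0, 0) : plane R)).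

Section torus_measurable.
Context {R : realType}.

Let pi (x : plane R) : torus R := \pi_(torus R) x.

(* Quotient sigma-algebra; this is the Borel sigma-algebra of the torus since
   the projection is an open map admitting a Borel section. *)
Definition torus_measurable : set (set (torus R)) :=
  image_set_system setT pi (@measurable _ (plane R)).

Let torus_sigma_algebra : sigma_algebra setT torus_measurable.
Proof. exact/sigma_algebra_image/sigma_algebra_measurable. Qed.

Let torus_measurable0 : torus_measurable set0.
Proof. by case: torus_sigma_algebra. Qed.

Let torus_measurableC A : torus_measurable A -> torus_measurable (~` A).
Proof. by case: torus_sigma_algebra => _ + _ => /[apply]; rewrite setTD. Qed.

Let torus_measurable_bigcup (F : (set (torus R))^nat) :
  (forall i, torus_measurable (F i)) -> torus_measurable (\bigcup_i F i).
Proof. by case: torus_sigma_algebra => _ _; exact. Qed.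

HB.instance Definition _ := isMeasurable.Build default_measure_display
  (torus R) torus_measurable0 torus_measurableC torus_measurable_bigcup.

Lemma measurable_torus_pi : measurable_fun [set: plane R] pi.
Proof. by move=> _ B mB; exact: mB. Qed.

Definition unit_square : set (plane R) := `[0, 1[ `*` `[0, 1[.

Lemma measurable_unit_square : measurable unit_square.
Proof. by apply: measurableX; exact: measurable_itv. Qed.

(* Pushing forward Lebesgue measure on a fundamental domain yields the
   normalized Haar measure. *)
Definition haar : set (torus R) -> \bar R :=
  pushforward (mrestr (@lebesgue_measure R \x @lebesgue_measure R)%E
                      measurable_unit_square) pi.

Let haar0 : haar set0 = 0%E.
Proof. by rewrite /haar /pushforward preimage_set0 measure0. Qed.

Let haar_ge0 A : (0 <= haar A)%E.
Proof. exact: measure_ge0. Qed.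

Let haar_sigma_additive : semi_sigma_additive haar.
Proof.
pose m := mrestr (@lebesgue_measure R \x @lebesgue_measure R)%E
  measurable_unit_square.
exact: (@measure_semi_sigma_additive _ _ _
  (measure_function_pushforward__canonical__measure_function_Measure
     m measurable_torus_pi)).
Qed.

HB.instance Definition _ := isMeasure.Build _ _ _ haar
  haar0 haar_ge0 haar_sigma_additive.

Let haar_setT : haar setT = 1%E.
Proof.
rewrite /haar /pushforward /mrestr preimage_setT setTI.
rewrite product_measure1E; try exact: measurable_itv.
by rewrite /= !lebesgue_measure_itv /= lte_fin ltr01 sube0 mule1.
Qed.

HB.instance Definition _ := Measure_isProbability.Build _ _ _ haar haar_setT.

End torus_measurable.
Arguments haar : clear implicits.

Section torus_action.
Context {R : realType}.

Definition plane_act (A : 'M[int]_2) (x : plane R) : plane R :=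
  ((A 0 0)%:~R * x.1 + (A 0 1)%:~R * x.2,
   (A 1 0)%:~R * x.1 + (A 1 1)%:~R * x.2).

(* Column-vector convention; independence of the representative is
   [torus_act_pi]. *)
Definition torus_act (A : 'M[int]_2) (xi : torus R) : torus R :=
  \pi_(torus R) (plane_act A (repr xi)).

Lemma torus_act_pi (A : 'M[int]_2) (x : plane R) :
  torus_act A (\pi_(torus R) x) = \pi_(torus R) (plane_act A x).
Proof.
apply/eqmodP.
have /eqmodP/andP[/= h1 h2] : repr (\pi_(torus R) x) = x %[mod torus R].
  by rewrite reprK.
apply/andP; split=> /=; rewrite opprD addrACA -!mulrBr rpredD// rpredM//;
  exact: intr_int.
Qed.

End torus_action.

Section complex_functions.
Context d (T : measurableType d) (R : realType).
Variable mu : {measure set T -> \bar R}.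
Implicit Types (f g : T -> R[i]) (p : \bar R).

Definition cmeasurable f : Prop :=
  measurable_fun setT (fun x => complex.Re (f x)) /\
  measurable_fun setT (fun x => complex.Im (f x)).

Definition cintegral f : R[i] :=
  Complex (\int[mu]_x complex.Re (f x)) (\int[mu]_x complex.Im (f x)).

Definition in_Lp p f : Prop :=
  cmeasurable f /\ (Lnorm mu p (fun x => (ComplexField.Normc.normc (f x))%:E) < +oo)%E.

Definition cdot f g : R[i] := cintegral (fun x => f x * conjc (g x)).

End complex_functions.

Section mixing.
Context {R : realType}.
Implicit Types (f g h : torus R -> R[i]) (T : 'M[int]_2).

Definition invariant T f : Prop :=
  {ae haar R, forall xi, f (torus_act T xi) = f xi}.

(* [g] represents the orthogonal projection of the class of [f] onto the
   subspace of T-invariant elements of L^2 *)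
Definition is_invproj T f g : Prop :=
  [/\ in_Lp (haar R) 2%:E g, invariant T g &
      forall h, in_Lp (haar R) 2%:E h -> invariant T h ->
        cdot (haar R) (f \- g) h = 0].

(* Elements of L^2 are handled through representatives: [invproj T f] is a
   chosen representative of the projection, which is unique only up to
   almost everywhere equality. *)
Definition invproj T f : torus R -> R[i] := xget (fun=> 0) (is_invproj T f).

(* [^o] selects the topology given by the complex modulus. *)
Definition relatively_jointly_mixing (k : nat) (T : 'I_k -> 'M[int]_2)
    (a : 'I_k -> nat -> int) : Prop :=
  forall (f : 'I_k -> torus R -> R[i]) (h : torus R -> R[i]),
    (forall i, in_Lp (haar R) +oo%E (f i)) -> in_Lp (haar R) +oo%E h ->
    (cintegral (haar R) (fun xi =>
       (\prod_(i < k) f i (torus_act (T i ^ a i n) xi)) * h xi) : R[i]^o)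
      @[n --> \oo] -->
    (cintegral (haar R) (fun xi =>
       (\prod_(i < k) invproj (T i) (f i) xi) * h xi) : R[i]^o).

Definition unipotent (T : 'M[int]_2) : Prop :=
  forall z : R[i], eigenvalue (map_mx intr T : 'M[R[i]]_2) z -> z = 1.

End mixing.
Arguments relatively_jointly_mixing : clear implicits.
Arguments unipotent : clear implicits.

(* Main.v *)
From HB Require Import structures.
Require Import Defs.
From mathcomp Require Import all_boot all_order all_algebra complex.
From mathcomp Require Import generic_quotient.
From mathcomp Require Import all_classical all_reals all_analysis.
From mathcomp Require Import measurable_realfun ess_sup_inf.
From mathcomp Require Import ring lra zify.
Import Order.TTheory GRing.Theory Num.Theory.
Import numFieldNormedType.Exports.

(** A unipotent T in SL(2, Z) satisfies (T - 1)^2 = 0, so T^z = 1 + z (T - 1),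
    and T - 1 has its image on a line R v with v an integer vector, v = (T - 1) u
    for a basis vector u.  Hence T^z moves every point of the torus along the
    flow xi |-> xi + t v, which is periodic with period 1, and the projection
    onto the T-invariant functions is expected to be the average of f over one
    period of that flow (flow_average).

    The heart of the matter is a shear estimate (flow_average_step).  In
    the integral of F(xi) G(T^z xi) substitute xi + (t / z) u for xi, which does
    not change the integral.  The point T^z (xi + (t / z) u) is T^z xi + t v up
    to the tiny translation (t / z) u, so by continuity of translations in mean
    (translation_continuous_integrable) the integral is close to that of
    F(xi) G(T^z xi + t v), as soon as F itself is nearly unchanged by the
    translations (t / z) u.  Averaging over t in [0, 1[ replaces G(T^z xi + t v)
    by flow_average v G (T^z xi), which equals flow_average v G xi because T^z
    only moves points along the flow.

    Take now F to be the product of h and of the first factors.  The exponents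
    grow at different speeds, so a translation of size 1 / a_k is still small
    after T_i^(a_i), i < k, has acted on it: F is nearly unchanged, and the last
    factor can be replaced by its flow average, absorbed into h, and the
    argument repeated (real_mixing).  No Fourier analysis is involved.

    With one factor, real_mixing also yields that f minus its flow average is
    orthogonal to every invariant function (flow_average_orthogonal): for an
    invariant h the integrals of f(T^n xi) h(xi) do not depend on n.  So the flow
    average is the projection, and any other representative of the projection
    agrees with it almost everywhere (invproj_cflow_average).  Complex functions
    are reduced to real ones by expanding the product multilinearly into real
    and imaginary parts (multilinear_expansion).

    Two facts on Haar measure are used: translations preserve it, because
    rotations of the circle preserve Lebesgue measure, and so do automorphisms,
    because a translation-invariant probability is unique
    (measure_preserving_torus_act). *)

Set Implicit Arguments.
Unset Strict Implicit.
Unset Printing Implicit Defensive.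
Local Open Scope classical_set_scope.
Local Open Scope ring_scope.

(** * Unipotent matrices and their flows *)

Section plane_vectors.
Context {R : realType}.

Definition vadd (x y : plane R) : plane R :=
  ((x.1 : R) + (y.1 : R), (x.2 : R) + (y.2 : R)).

Definition vscale (t : R) (x : plane R) : plane R :=
  (t * (x.1 : R), t * (x.2 : R)).

(** The vector v spans the closed flow along which T moves points, and u is a
    vector that T shears by exactly v.  When T = 1 the vector v is 0 and the flow is
    stationary. *)
Definition unipotent_flow (T : 'M[int]_2) (u v : plane R) : Prop :=
  [/\ (v.1 : R) \is a Num.int /\ (v.2 : R) \is a Num.int,
      forall z : int, \det (T ^ z) = 1,
      forall z : int, plane_act (T ^ z) u = vadd u (vscale z%:~R v) &
      forall x : plane R, exists c : R, forall z : int,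
        plane_act (T ^ z) x = vadd x (vscale (z%:~R * c) v)].

End plane_vectors.

Section unipotent_matrices.

Lemma det_mx22 (K : comPzRingType) (A : 'M[K]_2) :
  \det A = A 0 0 * A 1 1 - A 0 1 * A 1 0.
Proof.
rewrite (expand_det_row _ ord0) !big_ord_recl big_ord0 addr0 /cofactor !det_mx11 !mxE /=.
rewrite expr0 expr1 mul1r mulN1r mulrN.
by congr (A _ _ * A _ _ - A _ _ * A _ _); apply/val_inj.
Qed.

(** A complex matrix has an eigenvalue, here necessarily 1; then T - 1 is
    singular, and det (T - 1) = 2 - tr T when det T = 1. *)
Lemma unipotent_trace (R : realType) (T : 'M[int]_2) :
  \det T = 1 -> unipotent R T -> T 0 0 + T 1 1 = 2.
Proof.
move=> detT uT.
have [z zT] := @eigenvalue_closed _ _ (map_mx intr T : 'M[R[i]]_2) isT.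
have z1 := uT _ zT; move: zT; rewrite z1 => /eigenvalueP[v vT v0].
have : \det (map_mx intr (T - 1) : 'M[R[i]]_2) == 0.
  by apply/det0P; exists v => //; rewrite map_mxB map_mx1 mulmxBr vT mulmx1 scale1r subrr.
rewrite det_map_mx intr_eq0 det_mx22 !mxE /= => /eqP.
move: detT; rewrite det_mx22 => d e.
apply/eqP; rewrite -subr_eq0; apply/eqP.
transitivity ((T 0 0 * T 1 1 - T 0 1 * T 1 0 - 1) -
  ((T 0 0 - 1) * (T 1 1 - 1) - (T 0 1 - 0) * (T 1 0 - 0))); first by ring.
by rewrite d e.
Qed.

Variable T : 'M[int]_2.
Hypotheses (detT : \det T = 1) (trT : T 0 0 + T 1 1 = 2).

(** This is the Cayley-Hamilton identity for T - 1, whose trace and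
    determinant vanish. *)
Lemma unipotent_nilpotent : (T - 1) * (T - 1) = 0.
Proof.
move: detT trT; rewrite det_mx22 => d t.
have h : T 1 1 = 2 - T 0 0 by lia.
have h2 : T 0 1 * T 1 0 = - (T 0 0 - 1) ^+ 2.
  transitivity (- (T 0 0 * T 1 1 - T 0 1 * T 1 0) + T 0 0 * T 1 1); first by ring.
  by rewrite d h; ring.
have E (i j : 'I_2) : (T - 1) i 0 * (T - 1) 0 j + (T - 1) i 1 * (T - 1) 1 j = 0 ->
  ((T - 1) * (T - 1)) i j = 0.
  move=> <-; rewrite mxE !big_ord_recl big_ord0 addr0.
  by congr (_ + (T - 1) i _ * (T - 1) _ j); apply/val_inj.
have I2 (i : 'I_2) : i = 0 \/ i = 1.
  by case: i => -[|[|//]] ?; [left|right]; apply/val_inj.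
apply/matrixP => i j; rewrite [RHS]mxE; apply: E.
by have [->|->] := I2 i; have [->|->] := I2 j; rewrite !mxE /= ?h; nia.
Qed.

Lemma unipotent_exprz (z : int) : T ^ z = 1 + (T - 1) *~ z.
Proof.
have N0 := unipotent_nilpotent; set N := T - 1 in N0 *.
have TE : T = 1 + N by rewrite addrC subrK.
clearbody N.
have TX n : T ^+ n = 1 + N *+ n.
  elim: n => [|n IH]; first by rewrite expr0 mulr0n addr0.
  by rewrite exprS IH {1}TE mulrDl mul1r mulrDr mulr1 mulrnAr N0 mul0rn addr0 mulrSr addrA.
case: z => n; first exact: TX.
have uT : T ^+ n.+1 \is a GRing.unit.
  by apply: unitrX; rewrite -[_ \is a _]/(T \in unitmx) unitmxE detT unitr1.
rewrite NegzE mulrNz; apply: (mulrI uT).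
rewrite -[_ ^ _]/((T ^+ n.+1)^-1) divrr// TX -pmulrn.
by rewrite mulrDl mul1r mulrBr mulr1 mulrnAl mulrnAr N0 !mul0rn subr0 subrK.
Qed.

Lemma unipotent_exprzE (z : int) i j : (T ^ z) i j = (i == j)%:R + z * (T - 1) i j.
Proof. by rewrite unipotent_exprz -scaler_int !mxE intz. Qed.

Lemma det_unipotent_exprz (z : int) : \det (T ^ z) = 1.
Proof.
rewrite det_mx22 !unipotent_exprzE !mxE /=.
transitivity (1 + z * (T 0 0 + T 1 1 - 2) + z ^+ 2 *
  ((T 0 0 * T 1 1 - T 0 1 * T 1 0) - 1 - (T 0 0 + T 1 1 - 2))); first by ring.
by rewrite -det_mx22 detT trT !subrr mulr0 addr0 mulr0 addr0.
Qed.

(** The vector v is a column of T - 1 that vanishes only if T = 1, and u the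
    corresponding basis vector; the other column is a multiple of v since T - 1
    is singular. *)
Lemma exists_unipotent_flow (R : realType) :
  exists u v : plane R, unipotent_flow T u v.
Proof.
pose N := T - 1.
have TzE (z : int) (x : plane R) : plane_act (T ^ z) x =
    ((x.1 : R) + z%:~R * ((N 0 0)%:~R * (x.1 : R) + (N 0 1)%:~R * (x.2 : R)),
     (x.2 : R) + z%:~R * ((N 1 0)%:~R * (x.1 : R) + (N 1 1)%:~R * (x.2 : R))).
  rewrite /plane_act !unipotent_exprzE -/N /=.
  by congr pair; rewrite !intrD !intrM; ring.
have N11 : N 1 1 = - N 0 0.
  rewrite !mxE /=; apply/eqP; rewrite -subr_eq0; apply/eqP.
  by transitivity (T 0 0 + T 1 1 - 2); [ring|rewrite trT subrr].
have detN : N 0 0 * N 0 0 + N 0 1 * N 1 0 = 0.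
  rewrite !mxE /=.
  transitivity (T 0 0 * (T 0 0 + T 1 1 - 2) - (T 0 0 * T 1 1 - T 0 1 * T 1 0 - 1)); first by ring.
  by rewrite -det_mx22 detT trT !subrr mulr0 subr0.
have detNR : (N 0 0)%:~R * (N 0 0)%:~R + (N 0 1)%:~R * (N 1 0)%:~R = 0 :> R.
  by rewrite -!intrM -intrD detN.
have [N10|N10] := eqVneq (N 1 0) 0.
  have N00 : N 0 0 = 0.
    by move: detN => /eqP; rewrite N10 mulr0 addr0 mulf_eq0 orbb => /eqP.
  exists (0, 1), ((N 0 1)%:~R, 0); split => [||z|x] /=.
  - by rewrite intr_int rpred0.
  - exact: det_unipotent_exprz.
  - by rewrite TzE /vadd /vscale /= N11 N10 N00; congr pair; ring.
  - exists (x.2 : R) => z; rewrite TzE /vadd /vscale /= N11 N10 N00; congr pair; ring.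
exists (1, 0), ((N 0 0)%:~R, (N 1 0)%:~R); split => [||z|x] /=.
- by rewrite !intr_int.
- exact: det_unipotent_exprz.
- by rewrite TzE /vadd /vscale /=; congr pair; ring.
- have N10R : (N 1 0)%:~R != 0 :> R by rewrite intr_eq0.
  exists ((x.1 : R) - (N 0 0)%:~R / (N 1 0)%:~R * (x.2 : R)) => z.
  rewrite TzE /vadd /vscale /= N11; congr pair; last by rewrite mulrNz; field.
  have -> : (N 0 1)%:~R = - ((N 0 0)%:~R * (N 0 0)%:~R) / (N 1 0)%:~R :> R.
    by apply: (mulIf N10R); rewrite divfK//; apply/eqP; rewrite -addr_eq0 addrC detNR.
  by field.
Qed.

End unipotent_matrices.

(** * Measure-preserving maps and rotations of the circle *)

Section measure_preserving.
Context d1 d2 (T1 : measurableType d1) (T2 : measurableType d2) (R : realType).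
Variables (mu1 : {measure set T1 -> \bar R}) (mu2 : {measure set T2 -> \bar R}).

Definition measure_preserving (phi : T1 -> T2) : Prop :=
  measurable_fun setT phi /\
  forall A, measurable A -> mu1 (phi @^-1` A) = mu2 A.

Variable phi : T1 -> T2.
Hypothesis mp : measure_preserving phi.

Lemma ge0_integral_mp (f : T2 -> \bar R) : measurable_fun setT f ->
  (forall x, 0 <= f x)%E ->
  (\int[mu1]_x f (phi x) = \int[mu2]_x f x)%E.
Proof.
move: mp => [mphi mpE] mf f0.
rewrite -(@ge0_integral_pushforward _ _ _ _ _ _ mphi mu1 setT)//.
by apply: eq_measure_integral => A mA _; rewrite /= /pushforward mpE.
Qed.

Lemma Rintegral_mp (f : T2 -> R) : measurable_fun setT f ->
  \int[mu1]_x f (phi x) = \int[mu2]_x f x.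
Proof.
move=> /measurable_EFinP mf; congr fine.
rewrite [LHS]integralE [RHS]integralE.
rewrite -[fun x => (f (phi x))%:E]/((EFin \o f) \o phi).
rewrite funepos_comp funeneg_comp.
by congr (_ - _)%E; apply: ge0_integral_mp => //;
  [exact: measurable_funepos|exact: measurable_funeneg].
Qed.

Lemma ae_mp (P : T2 -> Prop) :
  {ae mu2, forall x, P x} -> {ae mu1, forall x, P (phi x)}.
Proof.
move=> [N [mN N0 PN]]; exists (phi @^-1` N); split.
- by rewrite -[X in measurable X]setTI; exact: mp.1.
- by rewrite mp.2.
- by move=> x /= nP; exact: PN.
Qed.

End measure_preserving.

Lemma measure_preserving_comp d1 d2 d3 (T1 : measurableType d1)
    (T2 : measurableType d2) (T3 : measurableType d3) (R : realType)
    (mu1 : {measure set T1 -> \bar R}) (mu2 : {measure set T2 -> \bar R})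
    (mu3 : {measure set T3 -> \bar R}) (phi : T1 -> T2) (psi : T2 -> T3) :
  measure_preserving mu1 mu2 phi -> measure_preserving mu2 mu3 psi ->
  measure_preserving mu1 mu3 (psi \o phi).
Proof.
move=> [mphi pE] [mpsi qE]; split; first exact: measurableT_comp.
move=> A mA; rewrite comp_preimage pE ?qE//.
by rewrite -[X in measurable X]setTI; exact: mpsi.
Qed.

Section bounded_measurable.
Context d (T : measurableType d) (R : realType).
Implicit Types f g : T -> R.

Definition bounded_measurable f : Prop :=
  measurable_fun setT f /\ exists M : R, forall x, `|f x| <= M.

Lemma bounded_measurable_cst c : bounded_measurable (fun=> c).
Proof. by split; [exact: measurable_cst|exists `|c|]. Qed.

Lemma bounded_measurableD f g : bounded_measurable f -> bounded_measurable g ->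
  bounded_measurable (fun x => f x + g x).
Proof.
move=> [mf [M fM]] [mg [K gK]]; split; first exact: measurable_funD.
by exists (M + K) => x; rewrite (le_trans (ler_normD _ _))// lerD.
Qed.

Lemma bounded_measurableB f g : bounded_measurable f -> bounded_measurable g ->
  bounded_measurable (fun x => f x - g x).
Proof.
move=> [mf [M fM]] [mg [K gK]]; split; first exact: measurable_funB.
by exists (M + K) => x; rewrite (le_trans (ler_normB _ _))// lerD.
Qed.

Lemma bounded_measurableM f g : bounded_measurable f -> bounded_measurable g ->
  bounded_measurable (fun x => f x * g x).
Proof.
move=> [mf [M fM]] [mg [K gK]]; split; first exact: measurable_funM.
by exists (M * K) => x; rewrite normrM ler_pM.
Qed.

Lemma bounded_measurable_norm f : bounded_measurable f ->
  bounded_measurable (fun x => `|f x|).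
Proof.
move=> [mf [M fM]]; split; first exact: measurableT_comp.
by exists M => x; rewrite normr_id.
Qed.

Lemma bounded_measurable_prod I (s : seq I) (F : I -> T -> R) :
  (forall i, bounded_measurable (F i)) ->
  bounded_measurable (fun x => \prod_(i <- s) F i x).
Proof.
move=> bF; elim: s => [|i s IH].
  under eq_fun do rewrite big_nil; exact: bounded_measurable_cst.
under eq_fun do rewrite big_cons; exact: bounded_measurableM.
Qed.

Lemma bounded_measurable_integrable (P : probability T R) f :
  bounded_measurable f -> P.-integrable setT (EFin \o f).
Proof.
move=> [mf [M fM]]; apply: measurable_bounded_integrable => //.
  by rewrite -ge0_fin_numE ?fin_num_measure.
exists M; split; first by rewrite num_real.
by move=> y My x _ /=; rewrite (le_trans (fM x))// ltW.
Qed.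

End bounded_measurable.

Lemma bounded_measurable_comp d1 d2 (T1 : measurableType d1)
    (T2 : measurableType d2) (R : realType) (phi : T1 -> T2) (f : T2 -> R) :
  measurable_fun setT phi -> bounded_measurable f ->
  bounded_measurable (f \o phi).
Proof.
move=> mphi [mf [M fM]]; split; first exact: measurableT_comp.
by exists M => x /=.
Qed.

Section circle.
Context {R : realType}.
Notation mu := (@lebesgue_measure R).

Definition fracpart (x : R) : R := x - (Num.floor x)%:~R.

Lemma fracpart_itv x : 0 <= fracpart x < 1.
Proof.
by rewrite subr_ge0 floor_le/= ltrBlDr addrC -[1]/(1%:~R) -intrD floorD1_gt.
Qed.

Lemma fracpartDz x (m : int) : fracpart (x + m%:~R) = fracpart x.
Proof. rewrite /fracpart floorDrz ?intr_int// intrKfloor intrD; lra. Qed.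

Lemma fracpart_id x : 0 <= x < 1 -> fracpart x = x.
Proof.
move=> x01; rewrite /fracpart (_ : Num.floor x = 0) ?subr0//.
by apply/eqP; rewrite floor_eq add0r.
Qed.

Lemma fracpartE x : x = fracpart x + (Num.floor x)%:~R.
Proof. by rewrite /fracpart subrK. Qed.

Lemma fracpart_eq x y : (fracpart x == fracpart y) = (x - y \is a Num.int).
Proof.
apply/eqP/idP => [xy|/intrP[m xy]]; last by rewrite -(subrK y x) addrC xy fracpartDz.
have -> : x - y = (Num.floor x - Num.floor y)%:~R.
  by move: xy; rewrite /fracpart intrB; lra.
exact: intr_int.
Qed.

Lemma measurable_fracpart : measurable_fun setT fracpart.
Proof.
apply: measurable_funB; first exact: measurable_id.
apply: nondecreasing_measurable => // x y xy.
by rewrite ler_int le_floor.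
Qed.

Lemma lebesgue_measure_shift (c : R) (A : set R) : measurable A ->
  mu ((fun x => x + c) @^-1` A) = mu A.
Proof.
move=> mA; pose phi : measurableTypeR R -> measurableTypeR R := fun x => x + c.
have mphi : measurable_fun setT phi by exact: measurable_funD.
pose m := measure_function_pushforward__canonical__measure_function_Measure mu mphi.
apply/esym; apply: (@lebesgue_measure_unique R m) => // _ [[a b] _ <-].
rewrite [RHS](_ : _ = mu `]a - c, b - c]%classic).
  rewrite !lebesgue_measure_itv/= !lte_fin ltrD2r -!EFinB.
  by rewrite (_ : b - c - (a - c) = b - a)//; lra.
congr (mu _); apply/seteqP; split => x /=; rewrite !in_itv/= /phi; lra.
Qed.

Definition circle_measure : set (measurableTypeR R) -> \bar R :=
  mrestr mu (@measurable_itv R `[0%R, 1%R[).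

HB.instance Definition _ := Measure.on circle_measure.

Let circle_measure_setT : circle_measure setT = 1%E.
Proof.
by rewrite /circle_measure /mrestr setTI lebesgue_measure_itv/= lte_fin ltr01 sube0.
Qed.

HB.instance Definition _ :=
  Measure_isProbability.Build _ _ _ circle_measure circle_measure_setT.

Definition rotation (c x : R) : R := fracpart (x + c).

(** The rotation by c in [0, 1[ cuts the circle at 1 - c and translates each
    of the two pieces. *)
Lemma measure_preserving_rotation (c : R) :
  measure_preserving circle_measure circle_measure
    (rotation c : measurableTypeR R -> measurableTypeR R).
Proof.
have mrot : measurable_fun setT (rotation c).
  by apply: measurableT_comp; [exact: measurable_fracpart|exact: measurable_funD].
split=> // A mA.
change (mu (rotation c @^-1` A `&` `[0, 1[) = mu (A `&` `[0, 1[)).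
have /andP[c0 c1] := fracpart_itv c; set e := fracpart c in c0 c1.
have rotE x : rotation c x = fracpart (x + e).
  by rewrite /rotation [in LHS](fracpartE c) addrA fracpartDz.
have mA1 : measurable (A `&` `[e, 1[) by exact: measurableI.
have mA2 : measurable (A `&` `[0, e[) by exact: measurableI.
rewrite (_ : _ `&` _ = ((fun x => x + e) @^-1` (A `&` `[e, 1[)) `|`
    ((fun x => x + (e - 1)) @^-1` (A `&` `[0, e[))); last first.
  apply/seteqP; split => x /=; rewrite !in_itv/= rotE.
    move=> [+ x01].
    have [xe|xe] := ltP (x + e) 1.
      by rewrite fracpart_id; [move=> ?; left; split=> //; lra|lra].
    rewrite -(subrK 1 (x + e)) -[X in _ + X](_ : 1%:~R = _)// fracpartDz.
    rewrite fracpart_id; last by lra.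
    by rewrite -addrA => ?; right; split => //; lra.
  case=> [[xA xe]|[xA xe]]; first by rewrite fracpart_id; [split=> //; lra|lra].
  rewrite -(subrK 1 (x + e)) -[X in _ + X](_ : 1%:~R = _)// fracpartDz -addrA.
  by rewrite fracpart_id; [split=> //; lra|lra].
have mD (h : R) (B : set R) : measurable B -> measurable ((fun x => x + h) @^-1` B).
  move=> mB; rewrite -[X in measurable X]setTI.
  exact: (measurable_funD (@measurable_id _ _ _) (measurable_cst h)).
rewrite measureU; [|exact: mD|exact: mD|].
  rewrite [X in (X + _)%E]lebesgue_measure_shift//.
  rewrite [X in (_ + X)%E]lebesgue_measure_shift//.
  rewrite -measureU//; last first.
    by apply/seteqP; split=> x //= -[[_]]; rewrite !in_itv/=; lra.
  rewrite -setIUr; congr (mu (_ `&` _)).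
  by apply/seteqP; split => x /=; rewrite !in_itv/=; [lra|case: (ltP x e); lra].
by apply/seteqP; split=> x //= -[[_ +] [_]]; rewrite !in_itv/=; lra.
Qed.

End circle.

(** * Translations and automorphisms of the torus *)

Section torus_translation.
Context {R : realType}.
Notation mu := (@lebesgue_measure R).
Notation circle := (@circle_measure R).
Local Open Scope quotient_scope.

Definition toT (x : plane R) : torus R := \pi_(torus R) x.

(** A Borel section of the projection of the plane onto the torus, with values
    in the unit square; a measurable function of a point of the torus is a function
    of these coordinates. *)
Definition sec (xi : torus R) : plane R :=
  (fracpart ((repr xi).1 : R), fracpart ((repr xi).2 : R)).

Lemma toT_eq (x y : plane R) :
  (x.1 : R) - y.1 \is a Num.int -> (x.2 : R) - y.2 \is a Num.int ->
  toT x = toT y.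
Proof. by move=> h1 h2; apply/eqmodP/andP. Qed.

Lemma sec_toT (x : plane R) : sec (toT x) = (fracpart (x.1 : R), fracpart (x.2 : R)).
Proof.
have /eqmodP/andP[/= h1 h2] : repr (toT x) = x %[mod torus R] by rewrite reprK.
by congr pair; apply/eqP; rewrite fracpart_eq.
Qed.

Lemma subr_fracpart_int (x : R) : x - fracpart x \is a Num.int.
Proof. by rewrite /fracpart opprB addrC subrK intr_int. Qed.

Lemma secK (xi : torus R) : toT (sec xi) = xi.
Proof.
by rewrite -[RHS]reprK; apply: toT_eq; rewrite /= -rpredN opprB subr_fracpart_int.
Qed.

Lemma measurable_toT : measurable_fun setT toT.
Proof. exact: measurable_torus_pi. Qed.

(** The preimage under the projection of the preimage under sec of B is the
    preimage of B under the coordinatewise fractional part, a Borel set. *)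
Lemma measurable_sec : measurable_fun setT sec.
Proof.
move=> _ B mB; rewrite setTI.
rewrite /measurable/= /torus_measurable /image_set_system/= setTI.
rewrite (_ : _ @^-1` _ = (fun x : plane R => (fracpart (x.1 : R), fracpart (x.2 : R))) @^-1` B).
  rewrite -[X in measurable X]setTI.
  suff : measurable_fun setT (fun x : plane R => (fracpart (x.1 : R), fracpart (x.2 : R)) : plane R).
    by apply.
  apply/measurable_fun_pair => /=.
    by apply: measurableT_comp; [exact: measurable_fracpart|exact: measurable_fst].
  by apply: measurableT_comp; [exact: measurable_fracpart|exact: measurable_snd].
by apply/seteqP; split => x /=; rewrite -[\pi_(torus R) x]/(toT x) sec_toT.
Qed.

Definition rotation2 (c x : plane R) : plane R :=
  (rotation (c.1 : R) (x.1 : R), rotation (c.2 : R) (x.2 : R)).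

(** The image of the product measure is again a product measure on rectangles,
    and that determines it. *)
Lemma measure_preserving_rotation2 (c : plane R) :
  measure_preserving (circle \x circle)%E (circle \x circle)%E (rotation2 c).
Proof.
have m1 := @measure_preserving_rotation R (c.1 : R).
have m2 := @measure_preserving_rotation R (c.2 : R).
have mrot : measurable_fun setT (rotation2 c).
  apply/measurable_fun_pair => /=.
    by apply: measurableT_comp; [exact: m1.1|exact: measurable_fst].
  by apply: measurableT_comp; [exact: m2.1|exact: measurable_snd].
split; first exact: mrot.
move=> A mA; apply/esym.
pose m := measure_function_pushforward__canonical__measure_function_Measure
  (circle \x circle)%E mrot.
apply: (@product_measure_unique _ _ _ _ _ circle circle m) => // X Y mX mY.
rewrite /= /pushforward /=.
rewrite (_ : _ @^-1` _ = (rotation c.1 @^-1` X) `*` (rotation c.2 @^-1` Y))//.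
rewrite [LHS]product_measure1E.
- by rewrite m1.2// m2.2.
- by rewrite -[X in measurable X]setTI; exact: m1.1.
- by rewrite -[X in measurable X]setTI; exact: m2.1.
Qed.

Lemma measure_preserving_toT : measure_preserving (circle \x circle)%E (haar R) toT.
Proof.
split=> [|A mA]; first exact: measurable_toT.
have mB : measurable (toT @^-1` A).
  by rewrite -[X in measurable X]setTI; exact: measurable_toT.
pose m := measure_function_mrestr__canonical__measure_function_Measure (mu \x mu)%E
  (@measurable_unit_square R).
apply: (@product_measure_unique _ _ _ _ _ circle circle m) => // X Y mX mY.
rewrite /= /mrestr /unit_square -setXI.
rewrite [LHS]product_measure1E//; exact: measurableI.
Qed.

Lemma measurable_vadd d (T : measurableType d) (f g : T -> plane R) :
  measurable_fun setT f -> measurable_fun setT g ->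
  measurable_fun setT (fun x => vadd (f x) (g x)).
Proof.
move=> mf mg; apply/measurable_fun_pair; apply: measurable_funD.
- exact: (measurableT_comp measurable_fst mf).
- exact: (measurableT_comp measurable_fst mg).
- exact: (measurableT_comp measurable_snd mf).
- exact: (measurableT_comp measurable_snd mg).
Qed.


Definition translate (c : plane R) (xi : torus R) : torus R := toT (vadd (sec xi) c).

Lemma translate_toT c x : translate c (toT x) = toT (vadd x c).
Proof.
rewrite /translate sec_toT; apply: toT_eq;
  by rewrite /= opprD addrACA subrr addr0 -rpredN opprB subr_fracpart_int.
Qed.

Lemma measurable_translate d (T : measurableType d) (c : T -> plane R)
    (f : T -> torus R) :
  measurable_fun setT c -> measurable_fun setT f ->
  measurable_fun setT (fun x => translate (c x) (f x)).
Proof.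
move=> mc mf; apply: measurableT_comp; first exact: measurable_toT.
by apply: measurable_vadd => //; apply: measurableT_comp mf; exact: measurable_sec.
Qed.

Lemma measure_preserving_translate c :
  measure_preserving (haar R) (haar R) (translate c).
Proof.
have ms : measurable_fun setT (translate c).
  by apply: measurable_translate; [exact: measurable_cst|exact: measurable_id].
split; first exact: ms.
move=> A mA.
have mB : measurable (toT @^-1` A).
  by rewrite -[X in measurable X]setTI; exact: measurable_toT.
have mC : measurable (translate c @^-1` A).
  by rewrite -[X in measurable X]setTI; exact: ms.
transitivity ((circle \x circle)%E (toT @^-1` (translate c @^-1` A))).
  exact/esym/(measure_preserving_toT.2 _ mC).
transitivity ((circle \x circle)%E (rotation2 c @^-1` (toT @^-1` A))).
  have E : translate c \o toT = toT \o rotation2 c.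
    apply/funext => x.
    by rewrite /= translate_toT; apply: toT_eq; rewrite /= subr_fracpart_int.
  by rewrite -[toT @^-1` _]/((translate c \o toT) @^-1` A) E.
transitivity ((circle \x circle)%E (toT @^-1` A)).
  exact: (measure_preserving_rotation2 c).2.
exact: measure_preserving_toT.2.
Qed.

Lemma measure_preserving_sec : measure_preserving (haar R) (circle \x circle)%E sec.
Proof.
split=> [|B mB]; first exact: measurable_sec.
have mC : measurable (sec @^-1` B).
  by rewrite -[X in measurable X]setTI; exact: measurable_sec.
transitivity ((circle \x circle)%E (toT @^-1` (sec @^-1` B))).
  exact/esym/(measure_preserving_toT.2 _ mC).
transitivity ((circle \x circle)%E (rotation2 (0, 0) @^-1` B)).
  have E : sec \o toT = rotation2 (0, 0).
    by apply/funext => x; rewrite /= sec_toT /rotation2/= /rotation !addr0.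
  by rewrite -[toT @^-1` _]/((sec \o toT) @^-1` B) E.
exact: (measure_preserving_rotation2 (0, 0)).2.
Qed.

Lemma torus_act_toT (A : 'M[int]_2) x :
  torus_act A (toT x) = toT (plane_act A x).
Proof. exact: torus_act_pi. Qed.

Lemma torus_act_translate (A : 'M[int]_2) c xi :
  torus_act A (translate c xi) = translate (plane_act A c) (torus_act A xi).
Proof.
rewrite -(secK xi) translate_toT !torus_act_toT translate_toT; congr toT.
by rewrite /plane_act /vadd /=; congr pair; rewrite !mulrDr addrACA.
Qed.

Lemma translate_translate c1 c2 xi : translate c1 (translate c2 xi) = translate (vadd c1 c2) xi.
Proof.
rewrite {2}/translate translate_toT /translate; congr toT.
by rewrite /vadd /=; congr pair; rewrite -addrA; congr (_ + _); rewrite addrC.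
Qed.

Lemma translateC xi eta : translate (sec xi) eta = translate (sec eta) xi.
Proof. by rewrite /translate /vadd; congr toT; congr pair; rewrite addrC. Qed.

Lemma measurable_torus_act (A : 'M[int]_2) : measurable_fun setT (@torus_act R A).
Proof.
rewrite (_ : torus_act A = toT \o plane_act A \o sec); last first.
  by apply/funext => xi /=; rewrite -{1}(secK xi) torus_act_toT.
apply: measurableT_comp measurable_sec.
apply: measurableT_comp; first exact: measurable_toT.
apply/measurable_fun_pair => /=; apply: measurable_funD;
  apply: measurable_funM => //.
Qed.

(** Uniqueness of Haar measure: the image nu of Haar measure under A is
    translation invariant, since A maps translations onto translations.
    Integrating the indicator of B at (A xi + eta) in both orders then gives
    nu B on one side and haar B on the other. *)
Lemma measure_preserving_torus_act (A : 'M[int]_2) : \det A = 1 ->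
  measure_preserving (haar R) (haar R) (torus_act A).
Proof.
move=> detA; have mA := measurable_torus_act A; split; first exact: mA.
have mAB B : measurable B -> measurable (@torus_act R A @^-1` B).
  by move=> mB; rewrite -[X in measurable X]setTI; exact: mA.
move=> B mB.
have detE : A 0 0 * A 1 1 - A 0 1 * A 1 0 = 1 by rewrite -det_mx22.
have translateE c : haar R (@torus_act R A @^-1` (translate c @^-1` B)) =
    haar R (@torus_act R A @^-1` B).
  (* e is the inverse image of c under A, by the adjugate formula *)
  pose e : plane R := ((A 1 1)%:~R * (c.1 : R) - (A 0 1)%:~R * (c.2 : R),
    (A 0 0)%:~R * (c.2 : R) - (A 1 0)%:~R * (c.1 : R)).
  have Ee : plane_act A e = c.
    have detR : (A 0 0)%:~R * (A 1 1)%:~R - (A 0 1)%:~R * (A 1 0)%:~R = 1 :> R.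
      by rewrite -!intrM -intrB detE.
    rewrite /e; case: c {e} => /= c1 c2; rewrite /plane_act /=; congr pair.
      rewrite -[RHS](mul1r (c1 : R)) -[X in _ = X * _]detR; ring.
    rewrite -[RHS](mul1r (c2 : R)) -[X in _ = X * _]detR; ring.
  have E : translate c \o @torus_act R A = @torus_act R A \o translate e.
    by apply/funext => xi; rewrite /= torus_act_translate Ee.
  rewrite -[_ @^-1` _]/((translate c \o @torus_act R A) @^-1` B) E.
  exact: (measure_preserving_translate e).2 _ (mAB _ mB).
pose h (x : torus R * torus R) : torus R := translate (sec x.1) (torus_act A x.2).
have mh : measurable_fun setT h.
  apply: measurable_translate.
    exact: (measurableT_comp measurable_sec measurable_fst).
  exact: (measurableT_comp mA measurable_snd).
have mf : measurable_fun setT (fun x => (\1_B (h x))%:E : \bar R).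
  apply/measurable_EFinP; apply: measurableT_comp mh.
  exact: measurable_indic.
have f0 x : (0 <= ((\1_B (h x))%:E : \bar R))%E by rewrite lee_fin.
have indE (phi : torus R -> torus R) : measurable_fun setT phi ->
    (\int[haar R]_y ((\1_B (phi y))%:E : \bar R) = haar R (phi @^-1` B))%E.
  move=> mphi; rewrite -[phi @^-1` B]setIT -integral_indic//.
  by rewrite -[X in measurable X]setTI; exact: mphi.
transitivity (\int[haar R]_x \int[haar R]_y ((\1_B (h (x, y)))%:E : \bar R))%E.
  under eq_integral => x _.
    rewrite (indE (translate (sec x) \o torus_act A)); last first.
      exact: measurableT_comp (measure_preserving_translate _).1 mA.
    rewrite -[_ @^-1` _]/(torus_act A @^-1` (translate (sec x) @^-1` B)) translateE.
    over.
  by rewrite integral_cst//= [X in (_ * X)%E](@probability_setT _ _ _ (haar R)) mule1.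
rewrite (@fubini_tonelli _ _ _ _ _ (haar R) (haar R) _ mf f0).
under eq_integral => y _.
  rewrite (_ : (\int[haar R]_x _)%E = haar R B); last first.
    transitivity (haar R (translate (sec (torus_act A y)) @^-1` B)).
      rewrite -indE; last exact: (measure_preserving_translate _).1.
      by apply: eq_integral => x _; rewrite /h/= translateC.
    exact: (measure_preserving_translate _).2.
  over.
by rewrite integral_cst//= [X in (_ * X)%E](@probability_setT _ _ _ (haar R)) mule1.
Qed.

End torus_translation.

(** * Continuity of translations in mean *)

Section translation_continuity.
Context {R : realType}.
Implicit Types (f g h : torus R -> R) (c : plane R) (A B : set (torus R)).
Local Notation mfun f := (measurable_fun setT f).

Definition L1norm f : \bar R := (\int[haar R]_xi `|f xi|%:E)%E.

Local Arguments L1norm f%_ring_scope.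

Lemma L1norm_ge0 f : (0 <= L1norm f)%E.
Proof. by apply: integral_ge0 => xi _; rewrite lee_fin. Qed.

Lemma measurable_absE f : mfun f -> measurable_fun setT (fun xi => `|f xi|%:E).
Proof. by move=> mf; apply/measurable_EFinP; exact: measurableT_comp. Qed.

Lemma le_L1norm f g : mfun f -> mfun g -> (forall xi, `|f xi| <= `|g xi|) ->
  (L1norm f <= L1norm g)%E.
Proof.
move=> mf mg fg; apply: ge0_le_integral => //.
- exact: measurable_absE.
- exact: measurable_absE.
- by move=> xi _; rewrite lee_fin.
Qed.

Lemma le_L1normD f g h : mfun f -> mfun g -> mfun h ->
  (forall xi, `|f xi| <= `|g xi| + `|h xi|) ->
  (L1norm f <= L1norm g + L1norm h)%E.
Proof.
move=> mf mg mh fgh.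
rewrite /L1norm -ge0_integralD//; try exact: measurable_absE.
apply: ge0_le_integral => //.
- exact: measurable_absE.
- by apply: emeasurable_funD; exact: measurable_absE.
- by move=> xi _; rewrite -EFinD lee_fin.
Qed.

Lemma L1normZ a f : mfun f -> L1norm (fun xi => a * f xi) = (`|a|%:E * L1norm f)%E.
Proof.
move=> mf; rewrite /L1norm -ge0_integralZl_EFin//.
- by apply: eq_integral => xi _; rewrite normrM.
- exact: measurable_absE.
Qed.

Lemma L1norm_mp f phi : measure_preserving (haar R) (haar R) phi -> mfun f ->
  L1norm (f \o phi) = L1norm f.
Proof.
by move=> mp mf; apply: (ge0_integral_mp mp (measurable_absE mf)) => xi; rewrite lee_fin.
Qed.

Lemma measurable_comp_translate f c : mfun f -> mfun (f \o translate c).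
Proof. by move=> mf; apply: measurableT_comp mf (measure_preserving_translate c).1. Qed.

Definition translate_diff c f : torus R -> R := fun xi => f (translate c xi) - f xi.

Lemma measurable_translate_diff c f : mfun f -> mfun (translate_diff c f).
Proof. by move=> mf; apply: measurable_funB => //; exact: measurable_comp_translate. Qed.

Definition small (delta : R) c := `|c.1 : R| < delta /\ `|c.2 : R| < delta.

Definition translation_continuous f : Prop :=
  forall e : R, 0 < e -> exists2 delta, 0 < delta &
    forall c, small delta c -> (L1norm (translate_diff c f) <= e%:E)%E.

Lemma translation_continuous_approx f : mfun f ->
  (forall e : R, 0 < e -> exists g, [/\ mfun g, translation_continuous g &
     (L1norm (fun xi => f xi - g xi)%R <= e%:E)%E]) ->
  translation_continuous f.
Proof.
move=> mf fg e e0; have e3 : 0 < e / 3 by rewrite divr_gt0.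
have [g [mg cg fge]] := fg _ e3; have [delta delta0 gd] := cg _ e3.
exists delta => // c cd.
have mfg : mfun (fun xi => f xi - g xi) by exact: measurable_funB.
have mfgs := measurable_comp_translate c mfg.
have mgs := measurable_translate_diff c mg.
apply: (le_trans (@le_L1normD _ ((fun xi => f xi - g xi) \o translate c)
  (fun xi => translate_diff c g xi - (f xi - g xi)) _ _ _ _)).
- exact: measurable_translate_diff.
- exact: mfgs.
- exact: measurable_funB.
- move=> xi; rewrite (le_trans _ (ler_normD _ _))// /translate_diff /= le_eqVlt.
  by apply/orP; left; apply/eqP; congr `|_|; ring.
have -> : e = e / 3 + (e / 3 + e / 3) by field.
rewrite EFinD; apply: leeD; first by rewrite L1norm_mp//; exact: measure_preserving_translate.
apply: (le_trans (@le_L1normD _ (translate_diff c g) (fun xi => f xi - g xi) _ _ _ _)) => //.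
- exact: measurable_funB.
- by move=> xi; exact: ler_normB.
by rewrite EFinD; apply: leeD => //; exact: gd.
Qed.

Lemma translation_continuousD f g : mfun f -> mfun g ->
  translation_continuous f -> translation_continuous g ->
  translation_continuous (fun xi => f xi + g xi).
Proof.
move=> mf mg cf cg e e0; have e2 : 0 < e / 2 by rewrite divr_gt0.
have [d1 d10 fd] := cf _ e2; have [d2 d20 gd] := cg _ e2.
exists (Num.min d1 d2); first by rewrite lt_min d10.
move=> c []; rewrite !lt_min => /andP[c11 c12] /andP[c21 c22].
have mfs := measurable_translate_diff c mf; have mgs := measurable_translate_diff c mg.
apply: (le_trans (@le_L1normD _ (translate_diff c f) (translate_diff c g) _ _ _ _)) => //.
- by apply: measurable_translate_diff; exact: measurable_funD.
- by move=> xi; rewrite /translate_diff opprD addrACA ler_normD.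
by rewrite [e]splitr EFinD; apply: leeD; [exact: fd|exact: gd].
Qed.

Lemma translation_continuousZ a f : mfun f ->
  translation_continuous f -> translation_continuous (fun xi => a * f xi).
Proof.
move=> mf cf e e0; have a1 : 0 < `|a| + 1 by rewrite ltr_wpDl.
have [d d0 fd] := cf (e / (`|a| + 1)) (divr_gt0 e0 a1).
exists d => // c cd.
rewrite (_ : translate_diff c _ = (fun xi => a * translate_diff c f xi)); last first.
  by apply/funext => xi; rewrite /translate_diff mulrBr.
rewrite L1normZ; last exact: measurable_translate_diff.
apply: (@le_trans _ _ ((`|a| + 1)%:E * (e / (`|a| + 1))%:E)%E).
  by apply: lee_pmul; [rewrite lee_fin|exact: L1norm_ge0|rewrite lee_fin lerDl|exact: fd].
by rewrite -EFinM mulrC divfK// gt_eqF.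
Qed.

(** The sets whose indicator is translation continuous will be shown to form a
    sigma-algebra that makes both coordinates measurable, hence to be all
    measurable sets. *)
Definition regular_set A := measurable A /\ translation_continuous (\1_A : torus R -> R).

Lemma measurable_translate_diff_indic c A : measurable A ->
  mfun (translate_diff c \1_A).
Proof. by move=> mA; apply: measurable_translate_diff; exact: measurable_indic. Qed.

Lemma regular_setC A : regular_set A -> regular_set (~` A).
Proof.
move=> [mA cA]; have mCA := measurableC mA; split => //.
move=> e e0; have [d d0 Ad] := cA e e0; exists d => // c cd.
apply: le_trans (Ad c cd); apply: le_L1norm.
- exact: measurable_translate_diff_indic.
- exact: measurable_translate_diff_indic.
move=> xi; rewrite /translate_diff !indicE !in_setC.
by case: (_ \in A); case: (_ \in A) => /=; rewrite ?subrr ?subr0 ?sub0r ?normrN.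
Qed.

Lemma regular_setU A B : regular_set A -> regular_set B -> regular_set (A `|` B).
Proof.
move=> [mA cA] [mB cB]; have mAB := measurableU _ _ mA mB; split => //.
move=> e e0; have e2 : 0 < e / 2 by rewrite divr_gt0.
have [d1 d10 Ad] := cA _ e2; have [d2 d20 Bd] := cB _ e2.
exists (Num.min d1 d2); first by rewrite lt_min d10.
move=> c []; rewrite !lt_min => /andP[c11 c12] /andP[c21 c22].
apply: (le_trans (@le_L1normD _ (translate_diff c \1_A) (translate_diff c \1_B) _ _ _ _)).
- exact: measurable_translate_diff_indic.
- exact: measurable_translate_diff_indic.
- exact: measurable_translate_diff_indic.
- move=> xi; rewrite /translate_diff !indicE !in_setU.
  by case: (_ \in A); case: (_ \in A); case: (_ \in B); case: (_ \in B) => /=;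
    rewrite ?subrr ?subr0 ?sub0r ?normrN ?normr1 ?normr0 ?addr0 ?lerDl ?add0r.
by rewrite [e]splitr EFinD; apply: leeD; [exact: Ad|exact: Bd].
Qed.

Lemma regular_set0 : regular_set set0.
Proof.
split=> // e e0; exists 1 => // c _.
rewrite (_ : translate_diff c _ = (fun=> 0 * 0)); last first.
  by apply/funext => xi; rewrite /translate_diff !indicE !in_set0 subrr mulr0.
by rewrite L1normZ// normr0 mul0e lee_fin ltW.
Qed.

(** A countable union is approximated in measure by its finite subunions. *)
Lemma regular_set_bigcup (F : (set (torus R))^nat) :
  (forall n, regular_set (F n)) -> regular_set (\bigcup_n F n).
Proof.
move=> nF; pose U n := \big[setU/set0]_(i < n.+1) F i.
have nU n : regular_set (U n).
  by rewrite /U; elim/big_ind : _ => //; [exact: regular_set0|exact: regular_setU].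
have mU n : measurable (U n) by have [] := nU n.
have mF : measurable (\bigcup_n F n) by apply: bigcupT_measurable => n; have [] := nF n.
have UF : \bigcup_n U n = \bigcup_n F n by exact: bigcup_bigsetU_bigcup.
split=> //; apply: translation_continuous_approx; first exact: measurable_indic.
move=> e e0.
have : (haar R \o U) n @[n --> \oo] --> haar R (\bigcup_n F n).
  rewrite -UF; apply: nondecreasing_cvg_mu => //; first by rewrite UF.
  by move=> n m nm; apply/subsetPset; exact: subset_bigsetU.
have fF := fin_num_measure (haar R) _ mF.
rewrite -(fineK fF) => /fine_cvg/cvgrPdist_le/(_ e e0)[n _ /(_ n (leqnn n)) /= Un].
have fU := fin_num_measure (haar R) _ (mU n).
have UnF : U n `<=` \bigcup_n F n by rewrite -UF; exact: bigcup_sup.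
exists (\1_(U n)); split; [exact: measurable_indic|by have [] := nU n|].
rewrite (_ : L1norm _ = haar R (\bigcup_n F n `\` U n)).
  rewrite measureD//; last by rewrite -ge0_fin_numE.
  rewrite setIidr// -(fineK fF) -(fineK fU) -EFinB lee_fin.
  exact: le_trans (ler_norm _) Un.
rewrite -[X in haar R X]setIT -integral_indic//; last exact: measurableD.
apply: eq_integral => xi _; rewrite !indicE in_setD.
have [xU|xU] := boolP (xi \in U n).
  by rewrite (mem_set (UnF _ (set_mem xU))) subrr normr0.
by rewrite subr0 andbT; case: (_ \in _); rewrite ?normr1 ?normr0.
Qed.

Let regular_set_sigma_algebra : sigma_algebra setT regular_set.
Proof.
split; first exact: regular_set0.
- by move=> A nA; rewrite setTD; exact: regular_setC.
- exact: regular_set_bigcup.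
Qed.

(** A translation by less than d changes the truth value of a < q only at points
    whose coordinate q is within d of the cut 0 = 1 or of a.  The coordinate q and
    the component cc of the translation are kept abstract so as to treat both
    coordinates at once. *)
Lemma regular_set_ray (q : torus R -> R) (cc : plane R -> R) (a : R) :
  measure_preserving (haar R) circle_measure q ->
  (forall xi, 0 <= q xi < 1) ->
  (forall c xi, q (translate c xi) = fracpart (q xi + cc c)) ->
  (forall c delta, small delta c -> `|cc c| < delta) ->
  regular_set (q @^-1` `]a, +oo[).
Proof.
move=> mq q01 qc ccd.
have mray : measurable (q @^-1` `]a, +oo[).
  by rewrite -[X in measurable X]setTI; exact: mq.1.
(* the bad points lie in three intervals of length 2 d, around 0, 1 and a *)
split => // e e0; pose d := Num.min (1 / 2) (e / 6).
have d0 : 0 < d by rewrite lt_min !divr_gt0.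
have [d2 d6] : d <= 1 / 2 /\ d <= e / 6 by rewrite /d !ge_min !lexx orbT.
clearbody d.
exists d => // c /ccd; set s := cc c => sd.
pose Z (z : R) : set (torus R) := q @^-1` `[z - d, z + d].
have mZ z : measurable (Z z) by rewrite -[X in measurable X]setTI; exact: mq.1.
have Zle z : (L1norm (\1_(Z z)) <= (2 * d)%:E)%E.
  rewrite /L1norm (_ : (\int[_]_xi _)%E = haar R (Z z)); last first.
    rewrite -[X in haar R X]setIT -integral_indic//.
    by apply: eq_integral => xi _; rewrite ger0_norm.
  rewrite mq.2//; apply: (@le_trans _ _ (lebesgue_measure (`[z - d, z + d]%classic : set R))).
    apply: le_measure; rewrite ?inE//; exact: measurableI.
  rewrite lebesgue_measure_itv/= lte_fin ltrD2l; case: ifP => _; last by rewrite lee_fin; lra.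
  by rewrite -EFinB lee_fin; lra.
have le3 : (L1norm (translate_diff c \1_(q @^-1` `]a, +oo[)) <=
    L1norm (\1_(Z 0%R)) + L1norm (fun xi => \1_(Z 1%R) xi + \1_(Z a) xi)%R)%E.
  apply: le_L1normD.
  - exact: measurable_translate_diff_indic.
  - exact: measurable_indic.
  - by apply: measurable_funD; exact: measurable_indic.
  move=> xi; rewrite /translate_diff [X in _ <= X + _]ger0_norm// [X in _ <= _ + X]ger0_norm ?addr_ge0//.
  rewrite !indicE.
  have -> : (translate c xi \in q @^-1` `]a, +oo[) = (a < fracpart (q xi + s)).
    by apply/idP/idP; rewrite inE /= in_itv/= andbT qc.
  have -> : (xi \in q @^-1` `]a, +oo[) = (a < q xi).
    by apply/idP/idP; rewrite inE /= in_itv/= andbT.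
  have ZE z : (xi \in Z z) = (z - d <= q xi <= z + d).
    by apply/idP/idP; rewrite inE /Z /= in_itv/=.
  rewrite !ZE; have := q01 xi; set y := q xi => y01.
  have [?|y0] := boolP (0 - d <= y <= 0 + d).
    apply: (@le_trans _ _ 1); last by rewrite lerDl addr_ge0.
    by do 2 case: (_ < _); rewrite ?subrr ?subr0 ?sub0r ?normrN ?normr1 ?normr0.
  have [?|y1] := boolP (1 - d <= y <= 1 + d).
    apply: (@le_trans _ _ 1); last by rewrite add0r lerDl.
    by do 2 case: (_ < _); rewrite ?subrr ?subr0 ?sub0r ?normrN ?normr1 ?normr0.
  have [?|ya] := boolP (a - d <= y <= a + d).
    apply: (@le_trans _ _ 1); last by rewrite !add0r.
    by do 2 case: (_ < _); rewrite ?subrr ?subr0 ?sub0r ?normrN ?normr1 ?normr0.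
  move: sd; rewrite ltr_norml => sd.
  rewrite fracpart_id; last by lra.
  rewrite !addr0 (_ : (a < y + s) = (a < y)) ?subrr ?normr0//.
  by apply/idP/idP; lra.
apply: (le_trans le3); apply: (@le_trans _ _ ((2 * d)%:E + ((2 * d)%:E + (2 * d)%:E))%E).
  apply: leeD; first exact: Zle.
  apply: (@le_trans _ _ (L1norm (\1_(Z 1%R)) + L1norm (\1_(Z a)))%E); last by apply: leeD; exact: Zle.
  apply: le_L1normD.
  - by apply: measurable_funD; exact: measurable_indic.
  - exact: measurable_indic.
  - exact: measurable_indic.
  - by move=> xi; exact: ler_normD.
by rewrite -!EFinD lee_fin; lra.
Qed.

Lemma measure_preserving_sec1 :
  measure_preserving (haar R) circle_measure (fun xi => (sec xi).1).
Proof.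
apply: (measure_preserving_comp (@measure_preserving_sec R)).
split; first exact: measurable_fst.
move=> A mA; rewrite (_ : _ @^-1` _ = A `*` setT); last first.
  by apply/seteqP; split=> -[x y] //= [].
rewrite [LHS]product_measure1E//.
by rewrite [X in (_ * X)%E](@probability_setT _ _ _ (@circle_measure R)) mule1.
Qed.

Lemma measure_preserving_sec2 :
  measure_preserving (haar R) circle_measure (fun xi => (sec xi).2).
Proof.
apply: (measure_preserving_comp (@measure_preserving_sec R)).
split; first exact: measurable_snd.
move=> A mA; rewrite (_ : _ @^-1` _ = setT `*` A); last first.
  by apply/seteqP; split=> -[x y] //= [].
rewrite [LHS]product_measure1E//.
by rewrite [X in (X * _)%E](@probability_setT _ _ _ (@circle_measure R)) mul1e.
Qed.

(** Equip the torus with the sigma-algebra of regular sets: both coordinates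
    are measurable for it because rays generate the Borel sets of the line, hence
    so is sec, and a measurable set is the preimage under sec of a Borel set. *)
Lemma measurable_regular_set A : measurable A -> regular_set A.
Proof.
move=> mA; have regularE := measurable_g_measurableTypeE regular_set_sigma_algebra.
pose sec' : g_sigma_algebraType regular_set -> plane R := @sec R.
have coord_measurable (q : torus R -> R) :
    (forall a, regular_set (q @^-1` `]a, +oo[)) ->
    measurable_fun setT (q : g_sigma_algebraType regular_set -> measurableTypeR R).
  move=> nq; apply: (measurability _ (RGenOInfty.measurableE R)).
  by move=> _ [_ [a ->] <-]; rewrite setTI regularE; exact: nq.
have msec : measurable_fun setT sec'.
  apply/measurable_fun_pair; apply: coord_measurable => a.
    apply: (regular_set_ray (cc := fun c => c.1) _ measure_preserving_sec1).
    - by move=> xi; exact: fracpart_itv.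
    - by move=> c xi; rewrite /translate sec_toT.
    - by move=> c delta [].
  apply: (regular_set_ray (cc := fun c => c.2) _ measure_preserving_sec2).
  - by move=> xi; exact: fracpart_itv.
  - by move=> c xi; rewrite /translate sec_toT.
  - by move=> c delta [].
have mB : measurable (@toT R @^-1` A).
  by rewrite -[X in measurable X]setTI; exact: measurable_toT.
have := msec measurableT _ mB; rewrite setTI regularE.
rewrite (_ : _ @^-1` _ = A)//.
by apply/seteqP; split => xi; rewrite /= /sec' secK.
Qed.

Import HBSimple.

(** Integrable functions are limits in mean of simple functions, and these are
    combinations of indicators of regular sets. *)
Theorem translation_continuous_integrable f :
  (haar R).-integrable setT (EFin \o f) -> translation_continuous f.
Proof.
move=> intf; have mf : mfun f by apply/measurable_EFinP; exact: measurable_int intf.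
have [g [_ _ gf]] := approximation_sfun_integrable measurableT intf.
apply: translation_continuous_approx => // e e0.
have : \forall n \near \oo, (L1norm (fun xi => f xi - g n xi)%R < e%:E)%E.
  apply: (gf [set x | (x < e%:E)%E]); apply: open_nbhs_nbhs; split.
    exact: open_ereal_lt_ereal.
  by rewrite /= lte_fin.
move=> [n _ /(_ n (leqnn n)) /ltW fgn]; exists (g n); split => //.
have mS y : measurable (g n @^-1` [set y]).
  by rewrite -[X in measurable X]setTI; exact: measurable_funP.
pose S (s : seq R) xi := \sum_(y <- s) y * \1_(g n @^-1` [set y]) xi.
have cS s : mfun (S s) /\ translation_continuous (S s).
  elim: s => [|y s [mSs cSs]].
    rewrite (_ : S _ = \1_set0); last by apply/funext => xi; rewrite /S big_nil indic0.
    by split; [exact: measurable_indic|have [] := regular_set0].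
  have [_ cy] := measurable_regular_set (mS y).
  have my : measurable_fun setT (\1_(g n @^-1` [set y]) : torus R -> R).
    exact: measurable_indic.
  rewrite (_ : S _ = fun xi => y * \1_(g n @^-1` [set y]) xi + S s xi); last first.
    by apply/funext => xi; rewrite /S big_cons.
  have myy : mfun (fun xi => y * \1_(g n @^-1` [set y]) xi).
    by apply: measurable_funM => //; exact: measurable_cst.
  split; first exact: measurable_funD.
  by apply: translation_continuousD => //; exact: translation_continuousZ.
rewrite (_ : (g n : _ -> _) = S (finmap.enum_fset (fset_set (range (g n))))).
  by have [] := cS (finmap.enum_fset (fset_set (range (g n)))).
by apply/funext => xi; rewrite fimfunE fsbig_finite.
Qed.

End translation_continuity.

(** * Averages along a closed flow *)

Section bounded_fubini.
Context d1 d2 (T1 : measurableType d1) (T2 : measurableType d2) (R : realType).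
Variables (P1 : probability T1 R) (P2 : probability T2 R).

Lemma normr_Rintegral_le (f : T1 -> R) (M : R) : bounded_measurable f ->
  (forall x, `|f x| <= M) -> `|\int[P1]_x f x| <= M.
Proof.
move=> bf fM; have intf := bounded_measurable_integrable P1 bf.
apply: (le_trans (le_normr_Rintegral measurableT intf)).
rewrite -[leRHS](_ : \int[P1]_x M = M); last first.
  by rewrite Rintegral_cst// [X in fine X](@probability_setT _ _ _ P1) mulr1.
apply: le_Rintegral => //.
- exact/bounded_measurable_integrable/bounded_measurable_norm.
- exact/bounded_measurable_integrable/bounded_measurable_cst.
Qed.

Variable h : T1 * T2 -> R.
Hypothesis bh : bounded_measurable h.

Let h1 x : bounded_measurable (fun y => h (x, y)).
Proof.
by apply: (bounded_measurable_comp (phi := fun y => (x, y)) _ bh); exact: measurable_pair1.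
Qed.

Let h2 y : bounded_measurable (fun x => h (x, y)).
Proof.
by apply: (bounded_measurable_comp (phi := fun x => (x, y)) _ bh); exact: measurable_pair2.
Qed.

Let integrable_h : (P1 \x P2)%E.-integrable setT (EFin \o h).
Proof.
have [mh [M hM]] := bh.
apply: measurable_bounded_integrable => //.
  rewrite -setXTT [X in (X < _)%E]product_measure1E//.
  rewrite [X in (X * _)%E](@probability_setT _ _ _ P1).
  by rewrite [X in (_ * X)%E](@probability_setT _ _ _ P2) mule1 ltry.
exists M; split; first by rewrite num_real.
by move=> y My x _ /=; rewrite (le_trans (hM x))// ltW.
Qed.

Let inner1 x : ((\int[P2]_y h (x, y))%:E = \int[P2]_y (h (x, y))%:E)%E.
Proof.
by rewrite fineK//; apply: integrable_fin_num => //; exact: bounded_measurable_integrable.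
Qed.

Let inner2 y : ((\int[P1]_x h (x, y))%:E = \int[P1]_x (h (x, y))%:E)%E.
Proof.
by rewrite fineK//; apply: integrable_fin_num => //; exact: bounded_measurable_integrable.
Qed.

Lemma bounded_measurable_Rintegral :
  bounded_measurable (fun x => \int[P2]_y h (x, y)).
Proof.
split.
  apply/measurable_EFinP; rewrite (_ : _ \o _ = fubini_F P2 (EFin \o h)).
    exact: measurable_fubini_F integrable_h.
  by apply/funext => x /=; rewrite inner1.
have [mh [M hM]] := bh; exists M => x.
have intx := bounded_measurable_integrable P2 (h1 x).
apply: (le_trans (le_normr_Rintegral measurableT intx)).
rewrite -[leRHS](_ : \int[P2]_x M = M); last first.
  by rewrite Rintegral_cst// [X in fine X](@probability_setT _ _ _ P2) mulr1.
apply: le_Rintegral => //.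
- exact/bounded_measurable_integrable/bounded_measurable_norm.
- exact/bounded_measurable_integrable/bounded_measurable_cst.
Qed.

Lemma bounded_Fubini :
  \int[P1]_x (\int[P2]_y h (x, y)) = \int[P2]_y (\int[P1]_x h (x, y)).
Proof.
congr fine; under eq_integral do rewrite inner1.
by under [RHS]eq_integral do rewrite inner2; exact: (Fubini integrable_h).
Qed.

End bounded_fubini.

Section flow_average.
Context {R : realType}.
Implicit Types (f g h : torus R -> R) (c : plane R) (v : plane R).

(** The average of f(xi + t v) over t in [0, 1].  The first coordinate of a
    Haar-distributed eta plays the role of the uniform variable t, so that Fubini
    and translation invariance on the torus are all that is needed. *)
Definition flow_average v f : torus R -> R :=
  fun xi => \int[haar R]_eta f (translate (vscale (sec eta).1 v) xi).

Let joint v (x : torus R * torus R) : torus R :=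
  translate (vscale (sec x.2).1 v) x.1.

Let measurable_joint v : measurable_fun setT (joint v).
Proof.
apply: measurable_translate; last exact: measurable_fst.
have m1 : measurable_fun setT (fun x : torus R * torus R => (sec x.2).1).
  apply: (measurableT_comp measurable_fst).
  exact: (measurableT_comp measurable_sec measurable_snd).
by apply/measurable_fun_pair; apply: measurable_funM => //; exact: measurable_cst.
Qed.

Lemma bounded_measurable_flow_average v f : bounded_measurable f ->
  bounded_measurable (flow_average v f).
Proof.
move=> bf; apply: (@bounded_measurable_Rintegral _ _ _ _ _ (haar R) (haar R) (f \o joint v)).
exact: bounded_measurable_comp.
Qed.

Lemma translate_vscaleD (s t : R) v xi :
  translate (vscale s v) (translate (vscale t v) xi) = translate (vscale (s + t) v) xi.
Proof.
by rewrite translate_translate; congr translate; congr pair; rewrite /= mulrDl.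
Qed.

Lemma translate_vscale_int (s t : R) v xi :
  (v.1 : R) \is a Num.int -> (v.2 : R) \is a Num.int -> s - t \is a Num.int ->
  translate (vscale s v) xi = translate (vscale t v) xi.
Proof.
move=> v1 v2 st; apply: toT_eq; rewrite /vadd /vscale.
  by rewrite -[_ - _ in X in is_true X]/(_ + s * v.1 - (_ + t * v.1)) opprD addrACA subrr add0r -mulrBl rpredM.
by rewrite -[_ - _ in X in is_true X]/(_ + s * v.2 - (_ + t * v.2)) opprD addrACA subrr add0r -mulrBl rpredM.
Qed.

Lemma plane_act_vscale (A : 'M[int]_2) (t : R) (x : plane R) :
  plane_act A (vscale t x) = vscale t (plane_act A x).
Proof. by rewrite /plane_act /vscale /=; congr pair; ring. Qed.

(** Translating along the flow shifts the parameter t by c; modulo 1 this is a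
    translation of eta, which preserves Haar measure. *)
Lemma flow_average_translate v f (c : R) xi : bounded_measurable f ->
  (v.1 : R) \is a Num.int -> (v.2 : R) \is a Num.int ->
  flow_average v f (translate (vscale c v) xi) = flow_average v f xi.
Proof.
move=> bf v1 v2; rewrite /flow_average.
have mf : measurable_fun setT (fun eta => f (translate (vscale (sec eta).1 v) xi)).
  apply: (measurableT_comp (f := f \o joint v) (g := fun eta => (xi, eta))).
    exact: measurableT_comp bf.1 _.
  exact: measurable_pair1.
rewrite -(Rintegral_mp (measure_preserving_translate (c, 0)) mf).
apply: eq_Rintegral => eta _; congr f.
rewrite translate_vscaleD; apply: translate_vscale_int => //.
by rewrite /translate sec_toT; exact: subr_fracpart_int.
Qed.

Lemma bounded_measurable_translate f c : bounded_measurable f ->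
  bounded_measurable (f \o translate c).
Proof.
by apply: bounded_measurable_comp; exact: (measure_preserving_translate c).1.
Qed.

Lemma bounded_measurable_act f (A : 'M[int]_2) : bounded_measurable f ->
  bounded_measurable (f \o torus_act A).
Proof. by apply: bounded_measurable_comp; exact: measurable_torus_act. Qed.

Lemma bounded_measurable_translate_diff f c : bounded_measurable f ->
  bounded_measurable (translate_diff c f).
Proof.
by move=> bf; apply: bounded_measurableB => //; exact: bounded_measurable_translate.
Qed.

Lemma RintegralM_le f g (M e : R) : bounded_measurable f -> bounded_measurable g ->
  (forall xi, `|g xi| <= M) -> (L1norm f <= e%:E)%E ->
  `|\int[haar R]_xi (f xi * g xi)| <= e * M.
Proof.
move=> bf bg gM fe.
have bfg := bounded_measurableM bf bg.
apply: (le_trans (le_normr_Rintegral measurableT (bounded_measurable_integrable (haar R) bfg))).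
have bnf := bounded_measurable_norm bf.
have infe := bounded_measurable_integrable (haar R) bnf.
apply: (@le_trans _ _ (\int[haar R]_xi (`|f xi| * M))).
  apply: le_Rintegral => //.
  - exact/bounded_measurable_integrable/bounded_measurable_norm.
  - by apply: bounded_measurable_integrable; apply: bounded_measurableM bnf _; exact: bounded_measurable_cst.
  - by move=> xi _; rewrite normrM ler_wpM2l.
rewrite RintegralZr//; apply: ler_wpM2r.
  by apply: le_trans (gM (\pi_(torus R) (0, 0))%qT); exact: normr_ge0.
by rewrite -lee_fin fineK//; exact: integrable_fin_num.
Qed.

Variables (T : 'M[int]_2) (u v : plane R).

Hypothesis Tuv : unipotent_flow T u v.

Lemma flow_average_act f (z : int) xi : bounded_measurable f ->
  flow_average v f (torus_act (T ^ z) xi) = flow_average v f xi.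
Proof.
move=> bf; have [[v1 v2] _ _ /(_ (sec xi))[c Tc]] := Tuv.
by rewrite -{1}(secK xi) torus_act_toT Tc; exact: flow_average_translate.
Qed.

(** The shear estimate.  With x = (t / z) u one has
    T^z (xi + x) = T^z xi + t v + x; the translation x is removed first from F,
    then from G, at a cost of e times a sup norm each, and the result is averaged
    over t. *)
Lemma flow_average_step (z : int) (F G : torus R -> R) (K M e : R) :
  z != 0 -> bounded_measurable F -> bounded_measurable G ->
  (forall xi, `|F xi| <= K) -> (forall xi, `|G xi| <= M) ->
  (forall t : R, 0 <= t < 1 ->
     (L1norm (translate_diff (vscale (t / z%:~R) u) F) <= e%:E)%E) ->
  (forall t : R, 0 <= t < 1 ->
     (L1norm (translate_diff (vscale (t / z%:~R) u) G) <= e%:E)%E) ->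
  `|\int[haar R]_xi (F xi * G (torus_act (T ^ z) xi)) -
    \int[haar R]_xi (F xi * flow_average v G xi)| <= e * M + e * K.
Proof.
move=> z0 bF bG FK GM Fe Ge; have [[v1 v2] detT Tu _] := Tuv.
have mpT := @measure_preserving_torus_act R _ (detT z).
pose A := @torus_act R (T ^ z).
have bGA : bounded_measurable (G \o A) by exact: bounded_measurable_act.
pose J t := \int[haar R]_xi (F xi * G (translate (vscale t v) (A xi))).
have Jt t : 0 <= t < 1 -> `|\int[haar R]_xi (F xi * G (A xi)) - J t| <= e * M + e * K.
  move=> t01; pose x := vscale (t / z%:~R) u.
  have Ax xi : A (translate x xi) = translate x (translate (vscale t v) (A xi)).
    rewrite /A torus_act_translate translate_translate; congr translate.
    rewrite plane_act_vscale Tu /vadd /vscale /=.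
    have zR : z%:~R != 0 :> R by rewrite intr_eq0.
    by congr pair; field.
  pose g2 := G \o translate (vscale t v) \o A.
  pose g1 := G \o translate x \o translate (vscale t v) \o A.
  have bg2 : bounded_measurable g2.
    by apply: bounded_measurable_act; exact: bounded_measurable_translate.
  have bg1 : bounded_measurable g1.
    apply: bounded_measurable_act; do 2 apply: bounded_measurable_translate; exact: bG.
  have bdF := bounded_measurable_translate_diff x bF.
  have bFg2 := bounded_measurableM bF bg2.
  have bFg1 := bounded_measurableM (bounded_measurable_translate x bF) bg1.
  have mGA := (bounded_measurableM bF bGA).1.
  rewrite -(Rintegral_mp (measure_preserving_translate x) mGA).
  rewrite -RintegralB//; try exact: bounded_measurable_integrable.
    rewrite (@eq_Rintegral _ _ _ _ _ (fun xi => translate_diff x F xi * g1 xi +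
        (g1 xi - g2 xi) * F xi)); last first.
      by move=> xi _; rewrite /translate_diff /g1 /g2 /= Ax; ring.
    rewrite RintegralD//.
    - apply: (le_trans (ler_normD _ _)); apply: lerD.
        by apply: (RintegralM_le bdF bg1 _ (Fe _ t01)) => xi; exact: GM.
      apply: RintegralM_le => //; first exact: bounded_measurableB.
      apply: le_trans (Ge _ t01).
      have mp := measure_preserving_comp mpT (measure_preserving_translate (vscale t v)).
      by rewrite -(L1norm_mp mp (bounded_measurable_translate_diff x bG).1).
    - by apply: bounded_measurable_integrable; exact: bounded_measurableM.
    - apply: bounded_measurable_integrable; apply: bounded_measurableM => //.
      exact: bounded_measurableB.
  exact: (bounded_measurable_integrable (haar R) (bounded_measurable_translate x (bounded_measurableM bF bGA))).
pose h (x : torus R * torus R) : R := F x.2 * G (joint v (A x.2, x.1)).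
have mA2 : measurable_fun setT (fun x : torus R * torus R => A x.2).
  exact: measurableT_comp (measurable_torus_act _) measurable_snd.
have bh : bounded_measurable h.
  apply: bounded_measurableM; first exact: bounded_measurable_comp measurable_snd bF.
  apply: (bounded_measurable_comp (phi := fun x => joint v (A x.2, x.1)) _ bG).
  apply: (measurableT_comp (measurable_joint v)).
  by apply/measurable_fun_pair => //; exact: measurable_fst.
have JE : (fun eta => \int[haar R]_xi h (eta, xi)) = (fun eta => J (sec eta).1) by [].
have -> : \int[haar R]_xi (F xi * flow_average v G xi) =
    \int[haar R]_eta J (sec eta).1.
  rewrite -JE (@bounded_Fubini _ _ _ _ _ (haar R) (haar R))//.
  apply: eq_Rintegral => xi _.
  rewrite -(flow_average_act z xi bG) -RintegralZl//.
  apply: bounded_measurable_integrable.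
  apply: (bounded_measurable_comp (phi := fun eta => joint v (A xi, eta)) _ bG).
  exact: (measurableT_comp (measurable_joint v) (measurable_pair1 _)).
rewrite -[X in X - _](_ : \int[haar R]_eta (\int[haar R]_xi (F xi * G (A xi))) = _); last first.
  by rewrite Rintegral_cst// [X in fine X](@probability_setT _ _ _ (haar R)) mulr1.
have bJ : bounded_measurable (fun eta => J (sec eta).1).
  exact: (@bounded_measurable_Rintegral _ _ _ _ _ (haar R) (haar R) h bh).
rewrite -RintegralB//.
- apply: normr_Rintegral_le.
    by apply: bounded_measurableB => //; exact: bounded_measurable_cst.
  by move=> eta; apply: Jt; exact: fracpart_itv.
- exact/bounded_measurable_integrable/bounded_measurable_cst.
- exact: bounded_measurable_integrable.
Qed.

End flow_average.

(** * Joint mixing for real functions *)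

Section slowly_varying.
Context {R : realType}.
Implicit Types (X : nat -> set (plane R)) (F G : nat -> torus R -> R).

(** A sequence of sets of translation vectors that shrink to 0; it carries the
    uniformity in t of the substitutions xi |-> xi + (t / a n) u. *)
Definition vanishing X : Prop :=
  forall delta : R, 0 < delta -> \forall n \near \oo, forall x, X n x -> small delta x.

Definition uniformly_bounded F : Prop :=
  (forall n, measurable_fun setT (F n)) /\
  exists2 M : R, 0 <= M & forall n xi, `|F n xi| <= M.

Definition slowly_varying X F : Prop :=
  forall e : R, 0 < e -> \forall n \near \oo,
    forall x, X n x -> (L1norm (translate_diff x (F n)) <= e%:E)%E.

Lemma uniformly_boundedP F : uniformly_bounded F -> forall n, bounded_measurable (F n).
Proof. by move=> [mF [M _ FM]] n; split=> //; exists M. Qed.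

Lemma bounded_measurable_ge0 (f : torus R -> R) : bounded_measurable f ->
  exists2 M : R, 0 <= M & forall xi, `|f xi| <= M.
Proof.
move=> [_ [M fM]]; exists M => //.
by apply: le_trans (fM (toT (0, 0))); exact: normr_ge0.
Qed.

Lemma uniformly_bounded_act (A : nat -> 'M[int]_2) f : bounded_measurable f ->
  uniformly_bounded (fun n => f \o torus_act (A n)).
Proof.
move=> bf; split=> [n|]; first by have [] := bounded_measurable_act (A n) bf.
by have [M M0 fM] := bounded_measurable_ge0 bf; exists M => // n xi /=.
Qed.

(** A translation by x of f composed with A is a translation by A x of f,
    followed by A, and A preserves Haar measure. *)
Lemma slowly_varying_act X (A : nat -> 'M[int]_2) f : bounded_measurable f ->
  (forall n, \det (A n) = 1) -> vanishing (fun n => plane_act (A n) @` X n) ->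
  slowly_varying X (fun n => f \o torus_act (A n)).
Proof.
move=> bf detA vX e e0.
have [d d0 fd] := translation_continuous_integrable (bounded_measurable_integrable (haar R) bf) e0.
near=> n => x Xx.
rewrite (_ : translate_diff x _ = translate_diff (plane_act (A n) x) f \o torus_act (A n)).
  have mp := @measure_preserving_torus_act R _ (detA n).
  rewrite (L1norm_mp mp (bounded_measurable_translate_diff _ bf).1).
  apply: fd; have : forall y, (plane_act (A n) @` X n) y -> small d y by near: n; exact: vX.
  by apply; exists x.
by apply/funext => xi; rewrite /translate_diff /= torus_act_translate.
Unshelve. all: by end_near. Qed.

Lemma uniformly_boundedM F G : uniformly_bounded F -> uniformly_bounded G ->
  uniformly_bounded (fun n xi => F n xi * G n xi).
Proof.
move=> [mF [M M0 FM]] [mG [K K0 GK]]; split=> [n|]; first exact: measurable_funM.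
by exists (M * K); [exact: mulr_ge0|move=> n xi; rewrite normrM ler_pM].
Qed.

(** The Leibniz rule for differences: the increment of F G is
    G(. + x) (F(. + x) - F) + F (G(. + x) - G). *)
Lemma slowly_varyingM X F G : uniformly_bounded F -> uniformly_bounded G ->
  slowly_varying X F -> slowly_varying X G ->
  slowly_varying X (fun n xi => F n xi * G n xi).
Proof.
move=> ubF ubG sF sG e e0.
have [bF bG] := (uniformly_boundedP ubF, uniformly_boundedP ubG).
have [_ [M M0 FM]] := ubF; have [_ [K K0 GK]] := ubG.
pose e' := e / (M + K + 1).
have MK : 0 < M + K + 1 by rewrite ltr_wpDl// addr_ge0.
have e'0 : 0 < e' by rewrite divr_gt0.
near=> n => x Xx.
have bdF := bounded_measurable_translate_diff x (bF n).
have bdG := bounded_measurable_translate_diff x (bG n).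
have bKF := bounded_measurableM (bounded_measurable_cst _ K) bdF.
have bMG := bounded_measurableM (bounded_measurable_cst _ M) bdG.
have bFG := bounded_measurable_translate_diff x (bounded_measurableM (bF n) (bG n)).
apply: (le_trans (le_L1normD bFG.1 bKF.1 bMG.1 _)) => [xi|].
  rewrite !normrM (ger0_norm K0) (ger0_norm M0) /translate_diff.
  set p := F n _; set q := G n _; set p' := F n xi; set q' := G n xi.
  rewrite (_ : p * q - p' * q' = q * (p - p') + p' * (q - q')); last by ring.
  apply: (le_trans (ler_normD _ _)); rewrite !normrM.
  by apply: lerD; apply: ler_wpM2r => //; [exact: GK|exact: FM].
rewrite (L1normZ _ bdF.1) (L1normZ _ bdG.1) (ger0_norm K0) (ger0_norm M0).
have dFe : (L1norm (translate_diff x (F n)) <= e'%:E)%E.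
  by move: x Xx {bdF bdG bKF bMG bFG}; near: n; exact: sF.
have dGe : (L1norm (translate_diff x (G n)) <= e'%:E)%E.
  by move: x Xx {bdF bdG bKF bMG bFG dFe}; near: n; exact: sG.
apply: (@le_trans _ _ (K%:E * e'%:E + M%:E * e'%:E)%E).
  by apply: leeD; apply: lee_wpmul2l; rewrite ?lee_fin.
rewrite -!EFinM -EFinD lee_fin -mulrDl.
apply: (@le_trans _ _ ((M + K + 1) * e')).
  by apply: ler_wpM2r; [exact: ltW|rewrite addrC lerDl].
by rewrite /e' mulrC divfK// gt_eqF.
Unshelve. all: by end_near. Qed.

Lemma slowly_varying_prod X I (s : seq I) (F : I -> nat -> torus R -> R) :
  (forall i, uniformly_bounded (F i)) -> (forall i, slowly_varying X (F i)) ->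
  uniformly_bounded (fun n xi => \prod_(i <- s) F i n xi) /\
  slowly_varying X (fun n xi => \prod_(i <- s) F i n xi).
Proof.
move=> ubF sF; elim: s => [|i s [ub sv]].
  split; first split=> [n|].
  - by under eq_fun do rewrite big_nil; exact: measurable_cst.
  - by exists 1 => // n xi; rewrite big_nil normr1.
  move=> e e0; near=> n => x _.
  rewrite (_ : translate_diff _ _ = (fun=> 0 * 0)).
    by rewrite L1normZ ?normr0 ?mul0e ?lee_fin ?ltW//; exact: measurable_cst.
  by apply/funext => xi; rewrite /translate_diff !big_nil subrr mulr0.
have E : (fun n xi => \prod_(j <- i :: s) F j n xi) =
    (fun n xi => F i n xi * \prod_(j <- s) F j n xi).
  by apply/funext => n; apply/funext => xi; rewrite big_cons.
by rewrite E; split; [exact: uniformly_boundedM|exact: slowly_varyingM].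
Unshelve. all: by end_near. Qed.

End slowly_varying.

Section real_mixing.
Context {R : realType}.

Lemma vanishing_segment (X : nat -> set (plane R)) (alpha beta : nat -> R)
    (p q : plane R) :
  alpha n @[n --> \oo] --> 0 -> beta n @[n --> \oo] --> 0 ->
  (forall n x, X n x -> exists2 t : R, 0 <= t < 1 &
     x = vadd (vscale (t * alpha n) p) (vscale (t * beta n) q)) ->
  vanishing X.
Proof.
move=> a0 b0 XE delta d0.
(* C bounds the coordinates of p and q; the 1 keeps it positive *)
pose C : R := `|p.1 : R| + `|p.2 : R| + `|q.1 : R| + `|q.2 : R| + 1.
have C0 : 0 < C by rewrite ltr_wpDl// !addr_ge0.
have eC : 0 < delta / (2 * C) by rewrite divr_gt0// mulr_gt0.
near=> n => x /XE[t /andP[t0 t1] ->].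
have an : `|alpha n| < delta / (2 * C) by near: n; apply: (cvgr0_norm_lt _ a0).
have bn : `|beta n| < delta / (2 * C) by near: n; apply: (cvgr0_norm_lt _ b0).
have bound (y z : R) : `|y| + `|z| < C -> `|t * alpha n * y + t * beta n * z| < delta.
  move=> yz; apply: (@le_lt_trans _ _ (delta / (2 * C) * `|y| + delta / (2 * C) * `|z|)).
    apply: (le_trans (ler_normD _ _)); rewrite !normrM (ger0_norm t0).
    by apply: lerD; apply: ler_wpM2r => //; rewrite -[leRHS]mul1r;
      apply: ler_pM => //; exact: ltW.
  rewrite -mulrDr; apply: (@le_lt_trans _ _ (delta / (2 * C) * C)).
    by apply: ler_wpM2l; exact: ltW.
  have -> : delta / (2 * C) * C = delta / 2 by field; rewrite gt_eqF.
  by rewrite ltr_pdivrMr// ltr_pMr// ltr1n.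
split; rewrite /vadd /vscale /=; apply: bound; rewrite /C.
  rewrite -!addrA ltrD2l; have := normr_ge0 (p.2 : R); have := normr_ge0 (q.2 : R); lra.
have := normr_ge0 (p.1 : R); have := normr_ge0 (q.1 : R); lra.
Unshelve. all: by end_near. Qed.

(** By induction on k: the last factor has the fastest growing exponent, and
    relative to it all the other factors vary slowly, so it may be replaced by its
    flow average, which joins h. *)
Theorem real_mixing (k : nat) (T : 'I_k -> 'M[int]_2) (u v : 'I_k -> plane R)
    (a : 'I_k -> nat -> int) (f : 'I_k -> torus R -> R) (h : torus R -> R) :
  (forall i, unipotent_flow (T i) (u i) (v i)) ->
  (forall i, ((a i n)%:~R : R)^-1 @[n --> \oo] --> 0) ->
  (forall i, \forall n \near \oo, a i n != 0) ->
  (forall i j : 'I_k, (i < j)%N ->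
     ((a i n)%:~R / (a j n)%:~R : R) @[n --> \oo] --> 0) ->
  (forall i, bounded_measurable (f i)) -> bounded_measurable h ->
  \int[haar R]_xi ((\prod_(i < k) f i (torus_act (T i ^ a i n) xi)) * h xi)
    @[n --> \oo] -->
  \int[haar R]_xi ((\prod_(i < k) flow_average (v i) (f i) xi) * h xi).
Proof.
elim: k T u v a f h => [|k IH] T u v a f h Tuv ainv a0 aratio bf bh.
  by apply: cvg_near_cst; near=> n; apply: eq_Rintegral => xi _; rewrite !big_ord0.
pose wid := widen_ord (leqnSn k).
pose F n xi := (\prod_(i < k) f (wid i) (torus_act (T (wid i) ^ a (wid i) n) xi)) * h xi.
pose G := f ord_max; pose m := @ord_max k.
pose X n : set (plane R) := [set x | exists2 t : R, 0 <= t < 1 &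
  x = vscale (t / (a m n)%:~R) (u m)].
have vX : vanishing X.
  apply: (vanishing_segment (alpha := fun n => ((a m n)%:~R)^-1) (beta := fun=> 0)
    (p := u m) (q := (0, 0)) (ainv m)); first exact: cvg_cst.
  move=> n x [t t01 ->]; exists t => //.
  by rewrite /vadd /vscale /=; congr pair; rewrite mulr0 addr0.
have vXi (i : 'I_k) : vanishing (fun n => plane_act (T (wid i) ^ a (wid i) n) @` X n).
  have [_ _ _ /(_ (u m))[c Tc]] := Tuv (wid i).
  apply: (vanishing_segment (p := u m) (q := vscale c (v (wid i))) (ainv m)
    (aratio (wid i) m (ltn_ord i))) => n _ [_ [t t01 ->] <-]; exists t => //.
  by rewrite plane_act_vscale Tc /vadd /vscale /=; congr pair; ring.
have sG : slowly_varying X (fun=> G).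
  move=> e e0.
  have [d d0 Gd] := translation_continuous_integrable
    (bounded_measurable_integrable (haar R) (bf m)) e0.
  by near=> n => x Xx; apply: Gd; move: x Xx; near: n; exact: vX.
have sh : slowly_varying X (fun=> h).
  move=> e e0.
  have [d d0 hd] := translation_continuous_integrable
    (bounded_measurable_integrable (haar R) bh) e0.
  by near=> n => x Xx; apply: hd; move: x Xx; near: n; exact: vX.
have [ubF sF] : uniformly_bounded F /\ slowly_varying X F.
  have ubi (i : 'I_k) : uniformly_bounded (fun n => f (wid i) \o torus_act (T (wid i) ^ a (wid i) n)).
    exact: uniformly_bounded_act.
  have svi (i : 'I_k) : slowly_varying X (fun n => f (wid i) \o torus_act (T (wid i) ^ a (wid i) n)).
    apply: slowly_varying_act => // n; by have [] := Tuv (wid i).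
  have [ubP sP] := slowly_varying_prod (index_enum 'I_k) ubi svi.
  have ubh : uniformly_bounded (fun=> h).
    split=> [n|]; first by have [] := bh.
    by have [M M0 hM] := bounded_measurable_ge0 bh; exists M.
  by split; [exact: uniformly_boundedM ubP ubh|exact: slowly_varyingM].
have bFav : bounded_measurable (fun xi => flow_average (v m) G xi * h xi).
  by apply: bounded_measurableM => //; exact: bounded_measurable_flow_average (bf m).
have := IH (T \o wid) (u \o wid) (v \o wid) (a \o wid) (f \o wid) _ _ _ _ _ _ bFav.
move=> /(_ (fun i => Tuv (wid i)) (fun i => ainv (wid i)) (fun i => a0 (wid i))
  (fun i j => aratio (wid i) (wid j)) (fun i => bf (wid i))) IHk.
rewrite (_ : \int[haar R]_xi ((\prod_(i < k.+1) flow_average (v i) (f i) xi) * h xi) = \int[haar R]_xi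
    ((\prod_(i < k) flow_average ((v \o wid) i) ((f \o wid) i) xi) *
     (flow_average (v m) G xi * h xi))); last first.
  by apply: eq_Rintegral => xi _; rewrite big_ord_recr/= mulrA.
have [_ [K K0 FK]] := ubF; have [M M0 GM] := bounded_measurable_ge0 (bf m).
have bF := uniformly_boundedP ubF.
apply/cvgrPdist_le => e e0.
pose e' := e / 2 / (M + K + 1).
have MK : 0 < M + K + 1 by rewrite ltr_wpDl// addr_ge0.
have e'0 : 0 < e' by rewrite !divr_gt0.
have e2 : 0 < e / 2 by rewrite divr_gt0.
near=> n.
have step := @flow_average_step R _ _ _ (Tuv m) (a m n) (F n) G K M e'.
have {step} : `|\int[haar R]_xi (F n xi * G (torus_act (T m ^ a m n) xi)) -
    \int[haar R]_xi (F n xi * flow_average (v m) G xi)| <= e / 2.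
  apply: (@le_trans _ _ (e' * M + e' * K)).
    apply: step => //; first by near: n; exact: a0.
    - exact: bf.
    - move=> t t01; have : forall x, X n x -> (L1norm (translate_diff x (F n)) <= e'%:E)%E.
        by near: n; exact: sF.
      by apply; exists t.
    - move=> t t01; have : forall x, X n x -> (L1norm (translate_diff x G) <= e'%:E)%E.
        by near: n; exact: sG.
      by apply; exists t.
  rewrite -mulrDr; apply: (@le_trans _ _ (e' * (M + K + 1))).
    by apply: ler_wpM2l; [exact: ltW|rewrite lerDl].
  by rewrite /e' divfK// gt_eqF.
set L := (X in `|X - _| <= e).
set I1 := \int[haar R]_xi (F n xi * flow_average (v m) G xi).
have LI : `|L - I1| <= e / 2.
  have -> : I1 = \int[haar R]_xi
    ((\prod_(i < k) (f \o wid) i (torus_act ((T \o wid) i ^ (a \o wid) i n) xi)) *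
     (flow_average (v m) G xi * h xi)).
    by apply: eq_Rintegral => xi _; rewrite /F -mulrA [h xi * _]mulrC.
  by near: n; move/cvgrPdist_le: IHk; apply.
have -> : \int[haar R]_xi ((\prod_(i < k.+1) f i (torus_act (T i ^ a i n) xi)) * h xi) =
    \int[haar R]_xi (F n xi * G (torus_act (T m ^ a m n) xi)).
  by apply: eq_Rintegral => xi _; rewrite big_ord_recr/= /F mulrAC.
rewrite distrC => I1e; rewrite (splitr e) -(subrKA I1).
by apply: (le_trans (ler_normD _ _)); apply: lerD.
Unshelve. all: by end_near. Qed.

End real_mixing.

(** * Invariant functions and flow averages *)

Section invariant_orthogonality.
Context {R : realType}.
Implicit Types (f g h : torus R -> R).

Lemma ae_eq_Rintegral f g : measurable_fun setT f -> measurable_fun setT g ->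
  {ae haar R, forall xi, f xi = g xi} ->
  \int[haar R]_xi f xi = \int[haar R]_xi g xi.
Proof.
move=> mf mg fg; congr fine; apply: ae_eq_integral => //.
- exact/measurable_EFinP.
- exact/measurable_EFinP.
- by apply: filterS fg => xi fg _; rewrite fg.
Qed.

Lemma torus_actM (A B : 'M[int]_2) (xi : torus R) :
  torus_act (A * B) xi = torus_act A (torus_act B xi).
Proof.
rewrite -(secK xi) !torus_act_toT; congr toT.
have mulE i j : (A * B) i j = A i 0 * B 0 j + A i 1 * B 1 j.
  rewrite mxE !big_ord_recl big_ord0 addr0.
  by congr (A _ _ * B _ _ + A _ _ * B _ _); apply/val_inj.
by rewrite /plane_act /= !mulE !intrD !intrM; congr pair; ring.
Qed.

Lemma torus_act1 (xi : torus R) : torus_act 1 xi = xi.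
Proof.
rewrite -[RHS]secK -{1}(secK xi) torus_act_toT; congr toT.
by rewrite /plane_act !mxE /= !mulr1z !mulr0z !mul1r !mul0r addr0 add0r.
Qed.

Variables (T : 'M[int]_2) (u v : plane R).
Hypothesis Tuv : unipotent_flow T u v.

Lemma invariant_exprz h (n : nat) :
  {ae haar R, forall xi, h (torus_act T xi) = h xi} ->
  {ae haar R, forall xi, h (torus_act (T ^ n) xi) = h xi}.
Proof.
move=> hT; have [_ /(_ 1) detT _ _] := Tuv; rewrite expr1z in detT.
have mpT := @measure_preserving_torus_act R _ detT.
elim: n => [|n IH]; first by apply: nearW => xi; rewrite expr0z torus_act1.
apply: filterS2 hT (ae_mp mpT IH) => xi h1 h2.
by rewrite -[T ^ _]/(T ^+ n.+1) exprSr torus_actM h2.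
Qed.

(** Since h is invariant, the integral of f(T^n xi) h(xi) is independent of n;
    its limit is given by real_mixing with one factor and exponents a n = n. *)
Lemma flow_average_orthogonal_bounded f h :
  bounded_measurable f -> bounded_measurable h ->
  {ae haar R, forall xi, h (torus_act T xi) = h xi} ->
  \int[haar R]_xi (f xi * h xi) = \int[haar R]_xi (flow_average v f xi * h xi).
Proof.
move=> bf bh hT.
have mixing := @real_mixing R 1 (fun=> T) (fun=> u) (fun=> v) (fun _ n => n)
  (fun=> f) h (fun=> Tuv) _ _ _ (fun=> bf) bh.
have lim1 : \int[haar R]_xi ((\prod_(i < 1) f (torus_act (T ^ n%:Z) xi)) * h xi)
    @[n --> \oo] --> \int[haar R]_xi (f xi * h xi).
  apply: cvg_near_cst; near=> n.
  have [_ /(_ n) detT _ _] := Tuv.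
  have mpT := @measure_preserving_torus_act R _ detT.
  have bfh := bounded_measurableM bf bh.
  rewrite -(Rintegral_mp mpT bfh.1); apply: ae_eq_Rintegral.
  - under eq_fun do rewrite big_ord1.
    by have [] := bounded_measurableM (bounded_measurable_act (T ^ n) bf) bh.
  - by have [] := bounded_measurable_act (T ^ n) bfh.
  - by apply: filterS (invariant_exprz n hT) => xi; rewrite big_ord1 => ->.
have lim2 : \int[haar R]_xi ((\prod_(i < 1) f (torus_act (T ^ n%:Z) xi)) * h xi)
    @[n --> \oo] --> \int[haar R]_xi (flow_average v f xi * h xi).
  have -> : \int[haar R]_xi (flow_average v f xi * h xi) =
      \int[haar R]_xi ((\prod_(i < 1) flow_average v f xi) * h xi).
    by apply: eq_Rintegral => xi _; rewrite big_ord1.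
  apply: mixing => [_|_|i j].
  - apply/gtr0_cvgV0; last exact: cvgr_idn.
    by exists 1%N => // -[].
  - by exists 1%N => // -[].
  - by rewrite !ord1.
exact: cvg_unique lim1 lim2.
Unshelve. all: by end_near. Qed.

(** Truncating h at level M keeps it invariant; let M tend to infinity by
    dominated convergence. *)
Lemma flow_average_orthogonal f h :
  bounded_measurable f -> (haar R).-integrable setT (EFin \o h) ->
  {ae haar R, forall xi, h (torus_act T xi) = h xi} ->
  \int[haar R]_xi ((f xi - flow_average v f xi) * h xi) = 0.
Proof.
move=> bf ih hT.
have mh : measurable_fun setT h by apply/measurable_EFinP; exact: measurable_int ih.
pose hM (M : nat) xi := if `|h xi| <= M%:R then h xi else 0.
have bD := bounded_measurableB bf (bounded_measurable_flow_average v bf).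
have bhM M : bounded_measurable (hM M).
  split.
    apply: measurable_fun_if => //.
    apply: measurable_fun_ler => //.
      exact: measurableT_comp.
    exact: measurable_funS mh.
  by exists M%:R => xi; rewrite /hM; case: ifP => //; rewrite normr0.
have DM M : \int[haar R]_xi ((f xi - flow_average v f xi) * hM M xi) = 0.
  under eq_Rintegral do rewrite mulrBl.
  rewrite RintegralB//; last 2 first.
  - by apply: bounded_measurable_integrable; exact: bounded_measurableM.
  - apply: bounded_measurable_integrable; apply: bounded_measurableM => //.
    exact: bounded_measurable_flow_average.
  rewrite (@flow_average_orthogonal_bounded f (hM M))// ?subrr//.
  by apply: filterS hT => xi; rewrite /hM => ->.
have [_ [K DK]] := bD.
have K0 : 0 <= K by apply: le_trans (DK (toT (0, 0))); exact: normr_ge0.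
have lim1 : (\int[haar R]_xi ((f xi - flow_average v f xi) * hM n xi)%:E)%E @[n --> \oo]
    --> (\int[haar R]_xi ((f xi - flow_average v f xi) * h xi)%:E)%E.
  apply: (@dominated_cvg _ _ _ (haar R) setT measurableT _ _ (fun xi => (K * `|h xi|)%:E)).
  - by move=> n; apply/measurable_EFinP; have [] := bounded_measurableM bD (bhM n).
  - move=> xi _; apply: cvg_near_cst; near=> n; congr EFin; rewrite /hM ifT//.
    by near: n; exact: nbhs_infty_ger.
  - by [].
  - under eq_fun do rewrite EFinM.
    by apply: integrableZl => //; apply: (integrable_abse ih).
  - move=> n xi _; rewrite /= normrM lee_fin; apply: ler_pM => //.
    by rewrite /hM; case: ifP => // _; rewrite normr0.
have lim0 : (\int[haar R]_xi ((f xi - flow_average v f xi) * hM n xi)%:E)%E @[n --> \oo]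
    --> (0 : \bar R)%E.
  apply: cvg_near_cst; near=> n.
  rewrite -[RHS]/(0%R%:E) -(DM n) fineK//; apply: integrable_fin_num => //.
  by apply: bounded_measurable_integrable; exact: bounded_measurableM.
by rewrite /Rintegral (cvg_unique _ lim1 lim0).
Unshelve. all: by end_near. Qed.

End invariant_orthogonality.

(** * The projection onto invariant functions *)

Section complex_projection.
Context {R : realType}.
Local Notation cRe := (@complex.Re R).
Local Notation cIm := (@complex.Im R).
Local Notation integrable a := ((haar R).-integrable setT (EFin \o a)).
Implicit Types (a b : torus R -> R) (f g h : torus R -> R[i]).

Definition square_integrable a : Prop :=
  measurable_fun setT a /\ integrable (fun xi => a xi ^+ 2).

Lemma integrable_le a b : measurable_fun setT a -> integrable b ->
  (forall xi, `|a xi| <= b xi) -> integrable a.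
Proof.
move=> ma ib ab; apply: le_integrable ib => //; first exact/measurable_EFinP.
by move=> xi _ /=; rewrite lee_fin (le_trans (ab xi))// ler_norm.
Qed.

Lemma integrableDR a b : integrable a -> integrable b ->
  integrable (fun xi => a xi + b xi).
Proof. by move=> ia ib; exact: (integrableD measurableT ia ib). Qed.

Lemma square_integrableM a b : square_integrable a -> square_integrable b ->
  integrable (fun xi => a xi * b xi).
Proof.
move=> [ma ia] [mb ib]; apply: (integrable_le _ (integrableDR ia ib)) => [|xi].
  exact: measurable_funM.
rewrite normrM -(real_normK (num_real (a xi))) -(real_normK (num_real (b xi))).
by have := normr_ge0 (a xi); have := normr_ge0 (b xi); nra.
Qed.

Lemma square_integrable_bounded a : bounded_measurable a -> square_integrable a.
Proof.
move=> ba; split; first by have [] := ba.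
exact: bounded_measurable_integrable (bounded_measurableM ba ba).
Qed.

Lemma square_integrableB a b : square_integrable a -> square_integrable b ->
  square_integrable (fun xi => a xi - b xi).
Proof.
move=> sa sb; have [[ma ia] [mb ib]] := (sa, sb).
have mab := measurable_funB ma mb; split => //.
have iab := integrableDR ia ib.
apply: (integrable_le _ (integrableDR iab iab)) => [|xi].
  exact: measurable_funX.
by rewrite ger0_norm ?sqr_ge0//; have := sqr_ge0 (a xi + b xi); nra.
Qed.

Lemma square_integrableW a : square_integrable a -> integrable a.
Proof.
move=> sa; have := square_integrableM sa
  (square_integrable_bounded (bounded_measurable_cst _ 1)).
by under eq_fun do rewrite mulr1.
Qed.

Lemma in_L2P f : in_Lp (haar R) 2%:E f <->
  square_integrable (cRe \o f) /\ square_integrable (cIm \o f).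
Proof.
have sqE xi : (`|(ComplexField.Normc.normc (f xi))%:E| `^ 2)%E =
    (cRe (f xi) ^+ 2 + cIm (f xi) ^+ 2)%:E.
  case: (f xi) => x y /=; rewrite ger0_norm ?sqrtr_ge0// powR_mulrn ?sqrtr_ge0//.
  by rewrite sqr_sqrtr// addr_ge0// sqr_ge0.
rewrite /in_Lp unlock; split.
  move=> [[mr mi]]; under eq_integral do rewrite sqE.
  have two0 : (2^-1 : R) != 0 by rewrite invr_eq0 pnatr_eq0.
  move=> /(lty_poweRy two0) fin.
  have msq : measurable_fun setT (fun xi => cRe (f xi) ^+ 2 + cIm (f xi) ^+ 2).
    by apply: measurable_funD; exact: measurable_funX.
  have isq : integrable (fun xi => cRe (f xi) ^+ 2 + cIm (f xi) ^+ 2).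
    apply/integrableP; split; first exact/measurable_EFinP.
    rewrite (_ : (\int[haar R]_xi _)%E =
      (\int[haar R]_xi (cRe (f xi) ^+ 2 + cIm (f xi) ^+ 2)%:E)%E)//.
    by apply: eq_integral => xi _ /=; rewrite ger0_norm// addr_ge0 ?sqr_ge0.
  split; split => //; apply: (integrable_le _ isq) => [|xi];
    rewrite ?ger0_norm ?sqr_ge0 ?lerDl ?lerDr ?sqr_ge0//; exact: measurable_funX.
move=> [[mr ir] [mi ii]]; split => //.
under eq_integral do rewrite sqE; apply: poweR_lty.
exact: (integrable_lty measurableT (integrableDR ir ii)).
Qed.

Lemma in_LooP f : in_Lp (haar R) +oo%E f -> cmeasurable f /\
  exists2 M : R, 0 <= M & {ae haar R, forall xi, `|cRe (f xi)| <= M /\ `|cIm (f xi)| <= M}.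
Proof.
rewrite /in_Lp unlock [X in (0 < X)%E](@probability_setT _ _ _ (haar R)) lte01.
move=> [mf fy]; split => //.
have [r [r0 fr]] : exists r : R, 0 <= r /\ (ess_sup (haar R)
    (abse \o (fun x => (ComplexField.Normc.normc (f x))%:E)) <= r%:E)%E.
  case: ess_sup fy => [r _||] //; last by exists 0; rewrite leNye.
  by exists (Num.max r 0); rewrite le_max lexx orbT lee_fin le_max lexx.
exists r => //; move/ess_supP : fr; apply: filterS => xi /=; rewrite lee_fin.
case: (f xi) => x y /=; rewrite ger0_norm ?sqrtr_ge0// => xyr.
split; apply: le_trans xyr; rewrite -sqrtr_sqr ler_sqrt ?lerDl ?lerDr ?sqr_ge0//;
  by rewrite addr_ge0// sqr_ge0.
Qed.

(** The flow average integrates over null sets, and real_mixing uses sup norms,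
    so essentially bounded functions are first truncated to bounded ones. *)
Lemma Loo_bounded_representative f : in_Lp (haar R) +oo%E f -> cmeasurable f /\
  exists a b, [/\ bounded_measurable a, bounded_measurable b &
    {ae haar R, forall xi, cRe (f xi) = a xi /\ cIm (f xi) = b xi}].
Proof.
move=> /in_LooP[mf [M M0 fM]]; split => //.
pose clip (c : torus R -> R) xi := if `|c xi| <= M then c xi else 0.
have bclip c : measurable_fun setT c -> bounded_measurable (clip c).
  move=> mc; split; last first.
    by exists M => xi; rewrite /clip; case: ifP => //; rewrite normr0.
  apply: measurable_fun_if => //; last exact: measurable_funS mc.
  by apply: measurable_fun_ler => //; exact: measurableT_comp.
exists (clip (cRe \o f)), (clip (cIm \o f)); split; [exact: bclip mf.1|exact: bclip mf.2|].
by apply: filterS fM => xi [r i]; rewrite /clip /= r i.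
Qed.

Lemma cdotE (D h : torus R -> R[i]) a b : cmeasurable D -> cmeasurable h ->
  measurable_fun setT a -> measurable_fun setT b ->
  {ae haar R, forall xi, cRe (D xi) = a xi /\ cIm (D xi) = b xi} ->
  cdot (haar R) D h = Complex
    (\int[haar R]_xi (a xi * cRe (h xi) + b xi * cIm (h xi)))
    (\int[haar R]_xi (b xi * cRe (h xi) - a xi * cIm (h xi))).
Proof.
move=> [mD1 mD2] [mh1 mh2] ma mb Dab; rewrite /cdot /cintegral.
have reE xi : cRe (D xi * conjc (h xi)) = cRe (D xi) * cRe (h xi) + cIm (D xi) * cIm (h xi).
  by case: (D xi) (h xi) => ? ? [? ?] /=; ring.
have imE xi : cIm (D xi * conjc (h xi)) = cIm (D xi) * cRe (h xi) - cRe (D xi) * cIm (h xi).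
  by case: (D xi) (h xi) => ? ? [? ?] /=; ring.
congr Complex.
  under eq_Rintegral do rewrite reE.
  apply: ae_eq_Rintegral.
  - by apply: measurable_funD; exact: measurable_funM.
  - by apply: measurable_funD; exact: measurable_funM.
  - by apply: filterS Dab => xi [-> ->].
under eq_Rintegral do rewrite imE.
apply: ae_eq_Rintegral.
- by apply: measurable_funB; exact: measurable_funM.
- by apply: measurable_funB; exact: measurable_funM.
- by apply: filterS Dab => xi [-> ->].
Qed.

Variables (T : 'M[int]_2) (u v : plane R).
Hypothesis Tuv : unipotent_flow T u v.
Variables (f : torus R -> R[i]) (a b : torus R -> R).
Hypotheses (mf : cmeasurable f) (ba : bounded_measurable a) (bb : bounded_measurable b).
Hypothesis fab : {ae haar R, forall xi, cRe (f xi) = a xi /\ cIm (f xi) = b xi}.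

Definition cflow_average xi : R[i] :=
  Complex (flow_average v a xi) (flow_average v b xi).

Let bEa := bounded_measurable_flow_average v ba.
Let bEb := bounded_measurable_flow_average v bb.

Let cdot_sub g h : in_Lp (haar R) 2%:E g -> in_Lp (haar R) 2%:E h ->
  cdot (haar R) (f \- g) h = Complex
    (\int[haar R]_xi ((a xi - cRe (g xi)) * cRe (h xi) + (b xi - cIm (g xi)) * cIm (h xi)))
    (\int[haar R]_xi ((b xi - cIm (g xi)) * cRe (h xi) - (a xi - cRe (g xi)) * cIm (h xi))).
Proof.
move=> /in_L2P[[mg1 _] [mg2 _]] /in_L2P[[mh1 _] [mh2 _]].
have [mf1 mf2] := mf; have [ma mb] := (ba.1, bb.1).
apply: cdotE => //.
- split.
    rewrite (_ : (fun x => _) = (fun x => cRe (f x) - cRe (g x))).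
      exact: measurable_funB.
    by apply/funext => xi /=; case: (f xi) (g xi) => ? ? [? ?].
  rewrite (_ : (fun x => _) = (fun x => cIm (f x) - cIm (g x))).
    exact: measurable_funB.
  by apply/funext => xi /=; case: (f xi) (g xi) => ? ? [? ?].
- exact: measurable_funB.
- exact: measurable_funB.
- apply: filterS fab => xi /=; case: (f xi) (g xi) => ? ? [? ?] /=.
  by move=> [-> ->].
Qed.

Lemma in_L2_cflow_average : in_Lp (haar R) 2%:E cflow_average.
Proof. by apply/in_L2P; split; exact: square_integrable_bounded. Qed.

Lemma invariant_cflow_average : Defs.invariant T cflow_average.
Proof.
apply: nearW => xi; rewrite /cflow_average -[T]expr1z.
by congr Complex; exact: (flow_average_act Tuv).
Qed.

Lemma is_invproj_cflow_average : is_invproj T f cflow_average.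
Proof.
split; [exact: in_L2_cflow_average|exact: invariant_cflow_average|].
move=> h hL hT; rewrite cdot_sub//; last exact: in_L2_cflow_average.
have /in_L2P[s1 s2] := hL.
have [i1 i2] := (square_integrableW s1, square_integrableW s2).
have hT1 : {ae haar R, forall xi, cRe (h (torus_act T xi)) = cRe (h xi)}.
  by apply: filterS hT => xi ->.
have hT2 : {ae haar R, forall xi, cIm (h (torus_act T xi)) = cIm (h xi)}.
  by apply: filterS hT => xi ->.
have sa := square_integrable_bounded (bounded_measurableB ba bEa).
have sb := square_integrable_bounded (bounded_measurableB bb bEb).
rewrite /= RintegralD//; try exact: square_integrableM.
rewrite RintegralB//; try exact: square_integrableM.
rewrite !(flow_average_orthogonal Tuv ba i1 hT1, flow_average_orthogonal Tuv ba i2 hT2,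
  flow_average_orthogonal Tuv bb i1 hT1, flow_average_orthogonal Tuv bb i2 hT2).
by rewrite addr0 subr0.
Qed.

(** If g is another projection, h = cflow_average - g is invariant and square
    integrable; testing both orthogonality relations against h shows that the
    integral of |h|^2 vanishes. *)
Lemma is_invproj_unique g : is_invproj T f g ->
  {ae haar R, forall xi, g xi = cflow_average xi}.
Proof.
move=> [gL gT gperp]; have [EL ET Eperp] := is_invproj_cflow_average.
pose h := cflow_average \- g.
have /in_L2P[sg1 sg2] := gL.
have sEa := square_integrable_bounded bEa; have sEb := square_integrable_bounded bEb.
have h1 xi : cRe (h xi) = flow_average v a xi - cRe (g xi).
  by rewrite /h /=; case: (g xi).
have h2 xi : cIm (h xi) = flow_average v b xi - cIm (g xi).
  by rewrite /h /=; case: (g xi).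
have sh1 : square_integrable (cRe \o h).
  have -> : cRe \o h = (fun xi => flow_average v a xi - cRe (g xi)).
    by apply/funext => xi; exact: h1.
  exact: square_integrableB sEa sg1.
have sh2 : square_integrable (cIm \o h).
  have -> : cIm \o h = (fun xi => flow_average v b xi - cIm (g xi)).
    by apply/funext => xi; exact: h2.
  exact: square_integrableB sEb sg2.
have hL : in_Lp (haar R) 2%:E h by apply/in_L2P.
have hT : Defs.invariant T h.
  by apply: filterS2 gT ET => xi e1 e2; rewrite /h /= e1 e2.
have := gperp h hL hT; have := Eperp h hL hT.
rewrite !cdot_sub// => -[E1 _] [E2 _].
have [[mh1 ih1] [mh2 ih2]] := (sh1, sh2).
have sa := square_integrable_bounded ba; have sb := square_integrable_bounded bb.
have h0 : \int[haar R]_xi (cRe (h xi) ^+ 2 + cIm (h xi) ^+ 2) = 0.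
  rewrite -[RHS](subrr 0) -{1}E2 -{1}E1 -RintegralB//.
  - by apply: eq_Rintegral => xi _; rewrite /= !h1 !h2 /=; ring.
  - by apply: integrableDR; apply: square_integrableM => //; exact: square_integrableB.
  - by apply: integrableDR; apply: square_integrableM => //; exact: square_integrableB.
have ih := integrableDR ih1 ih2.
have mh := measurable_int _ ih.
have /(ae_eq_integral_abs (haar R) measurableT mh) :
    (\int[haar R]_xi `|(EFin \o (fun xi => cRe (h xi) ^+ 2 + cIm (h xi) ^+ 2)%R) xi| = 0)%E.
  transitivity ((\int[haar R]_xi (cRe (h xi) ^+ 2 + cIm (h xi) ^+ 2))%R%:E); last by rewrite h0.
  rewrite fineK; last exact: integrable_fin_num.
  by apply: eq_integral => xi _ /=; rewrite ger0_norm// addr_ge0 ?sqr_ge0.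
apply: filterS => xi /(_ I) /= [] /eqP; rewrite paddr_eq0 ?sqr_ge0// !sqrf_eq0 h1 h2.
rewrite !subr_eq0 /cflow_average => /andP[/eqP -> /eqP ->].
by case: (g xi).
Qed.

Lemma invproj_cflow_average : {ae haar R, forall xi, invproj T f xi = cflow_average xi}.
Proof.
apply: is_invproj_unique; rewrite /invproj.
by case: xgetP => // /(_ _ is_invproj_cflow_average).
Qed.

End complex_projection.

(** * Complex functions and growth of the exponents *)

Section complex_expansion.
Context {R : realType}.
Local Notation cRe := (@complex.Re R).
Local Notation cIm := (@complex.Im R).
Implicit Types f g : torus R -> R[i].

Lemma cvg_complex (x y : nat -> R) (a b : R) :
  x n @[n --> \oo] --> a -> y n @[n --> \oo] --> b ->
  (Complex (x n) (y n) : R[i]^o) @[n --> \oo] --> (Complex a b : R[i]^o).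
Proof.
move=> xa yb; apply/cvgrPdist_le => -[e e'].
rewrite ltcE /= => /andP[/eqP -> e0] /=; have e2 : 0 < e / 2 by rewrite divr_gt0.
near=> n.
have xe : `|a - x n| <= e / 2 by near: n; move/cvgrPdist_le: xa; apply.
have ye : `|b - y n| <= e / 2 by near: n; move/cvgrPdist_le: yb; apply.
have -> : Complex a b - Complex (x n) (y n) = Complex (a - x n) (b - y n) :> R[i] by [].
change ((ComplexField.Normc.normc (Complex (a - x n) (b - y n)))%:C%C <= e%:C%C).
rewrite lecR /= -(ger0_norm (ltW e0)) -sqrtr_sqr ler_sqrt ?sqr_ge0//.
move: xe ye; rewrite !ler_norml => /andP[x1 x2] /andP[y1 y2].
by nra.
Unshelve. all: by end_near. Qed.

Lemma cintegral_ae_eq f g : cmeasurable f -> cmeasurable g ->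
  {ae haar R, forall xi, f xi = g xi} ->
  cintegral (haar R) f = cintegral (haar R) g.
Proof.
move=> [mf1 mf2] [mg1 mg2] fg; congr Complex; apply: ae_eq_Rintegral => //;
  by apply: filterS fg => xi ->.
Qed.

Lemma cmeasurableM f g : cmeasurable f -> cmeasurable g ->
  cmeasurable (fun xi => f xi * g xi).
Proof.
move=> [mf1 mf2] [mg1 mg2]; split.
  rewrite (_ : (fun x => _) = fun xi => cRe (f xi) * cRe (g xi) - cIm (f xi) * cIm (g xi)).
    by apply: measurable_funB; exact: measurable_funM.
  by apply/funext => xi; case: (f xi) (g xi) => ? ? [].
rewrite (_ : (fun x => _) = fun xi => cRe (f xi) * cIm (g xi) + cIm (f xi) * cRe (g xi)).
  by apply: measurable_funD; exact: measurable_funM.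
by apply/funext => xi; case: (f xi) (g xi) => ? ? [].
Qed.

Lemma cmeasurable_prod I (s : seq I) (F : I -> torus R -> R[i]) :
  (forall i, cmeasurable (F i)) -> cmeasurable (fun xi => \prod_(i <- s) F i xi).
Proof.
move=> mF; elim: s => [|i s IH].
  under eq_fun do rewrite big_nil.
  by split; exact: measurable_cst.
by under eq_fun do rewrite big_cons; exact: cmeasurableM.
Qed.

(** The coefficients of the real part (true) and of the imaginary part (false);
    a boolean index lets the distributive law be applied to a product of sums. *)
Definition unit_part (b : bool) : R[i] := if b then 1 else Complex 0 1.

Lemma complex_split (a b : R) (x : bool -> R) : x true = a -> x false = b ->
  Complex a b = \sum_(c : bool) unit_part c * (x c)%:C%C.
Proof.
move=> <- <-; rewrite big_bool /= /unit_part mul1r.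
by apply/eqP; rewrite eq_complex /=; apply/andP; split; apply/eqP; ring.
Qed.

Lemma bounded_measurable_sum J (s : seq J) (r : J -> R) (w : J -> torus R -> R) :
  (forall j, bounded_measurable (w j)) ->
  bounded_measurable (fun xi => \sum_(j <- s) r j * w j xi).
Proof.
move=> bw; elim: s => [|j s IH].
  under eq_fun do rewrite big_nil; exact: bounded_measurable_cst.
under eq_fun do rewrite big_cons.
apply: bounded_measurableD => //.
exact: bounded_measurableM (bounded_measurable_cst _ _) (bw j).
Qed.

Lemma Rintegral_sum J (s : seq J) (r : J -> R) (w : J -> torus R -> R) :
  (forall j, bounded_measurable (w j)) ->
  \int[haar R]_xi (\sum_(j <- s) r j * w j xi) =
  \sum_(j <- s) r j * \int[haar R]_xi w j xi.
Proof.
move=> bw; elim: s => [|j s IH].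
  under eq_Rintegral do rewrite big_nil.
  by rewrite Rintegral_cst// mul0r big_nil.
under eq_Rintegral do rewrite big_cons.
rewrite big_cons RintegralD//.
- by rewrite IH RintegralZl//; exact: bounded_measurable_integrable.
- apply: bounded_measurable_integrable.
  exact: bounded_measurableM (bounded_measurable_cst _ _) (bw j).
- by apply: bounded_measurable_integrable; exact: bounded_measurable_sum.
Qed.

Lemma Re_sum J (s : seq J) (C : J -> R[i]) (x : J -> R) :
  cRe (\sum_(j <- s) C j * (x j)%:C%C) = \sum_(j <- s) cRe (C j) * x j.
Proof.
rewrite (big_morph cRe (id1 := 0) (op1 := +%R)) => [| [? ?] [? ?]|] //.
by apply: eq_bigr => j _; case: (C j) => ? ? /=; rewrite mulr0 subr0.
Qed.

Lemma Im_sum J (s : seq J) (C : J -> R[i]) (x : J -> R) :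
  cIm (\sum_(j <- s) C j * (x j)%:C%C) = \sum_(j <- s) cIm (C j) * x j.
Proof.
rewrite (big_morph cIm (id1 := 0) (op1 := +%R)) => [| [? ?] [? ?]|] //.
by apply: eq_bigr => j _; case: (C j) => ? ? /=; rewrite mulr0 add0r.
Qed.

Lemma cmeasurable_sum J (s : seq J) (C : J -> R[i]) (w : J -> torus R -> R) :
  (forall j, bounded_measurable (w j)) ->
  cmeasurable (fun xi => \sum_(j <- s) C j * (w j xi)%:C%C).
Proof.
move=> bw; split.
  under eq_fun do rewrite Re_sum.
  by have [] := bounded_measurable_sum s (fun j => cRe (C j)) bw.
under eq_fun do rewrite Im_sum.
by have [] := bounded_measurable_sum s (fun j => cIm (C j)) bw.
Qed.

Lemma cintegral_sum J (s : seq J) (C : J -> R[i]) (w : J -> torus R -> R) :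
  (forall j, bounded_measurable (w j)) ->
  cintegral (haar R) (fun xi => \sum_(j <- s) C j * (w j xi)%:C%C) =
  Complex (\sum_(j <- s) cRe (C j) * \int[haar R]_xi w j xi)
          (\sum_(j <- s) cIm (C j) * \int[haar R]_xi w j xi).
Proof.
move=> bw; rewrite -!Rintegral_sum//.
by congr Complex; apply: eq_Rintegral => xi _; [exact: Re_sum|exact: Im_sum].
Qed.

Lemma multilinear_expansion (k : nat) (x : 'I_k -> bool -> R) (y : bool -> R) :
  (\prod_(i < k) \sum_(b : bool) unit_part b * (x i b)%:C%C) *
    (\sum_(b : bool) unit_part b * (y b)%:C%C) =
  \sum_(j : {ffun 'I_k -> bool} * bool)
    ((\prod_(i < k) unit_part (j.1 i)) * unit_part j.2) *
    ((\prod_(i < k) x i (j.1 i)) * y j.2)%:C%C.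
Proof.
rewrite bigA_distr_bigA big_distrlr /= pair_big /=; apply: eq_bigr => j _.
by rewrite big_split /= rmorphM rmorph_prod mulrACA.
Qed.

End complex_expansion.

Section growth.
Context {R : realType} (k : nat) (hk : (1 <= k)%N) (a : 'I_k -> nat -> int).
Hypothesis ha : ((a (Ordinal hk) n)%:~R : R) @[n --> \oo] --> +oo.
Hypothesis hratio : forall i j : 'I_k, j = i.+1 :> nat ->
  ((a j n)%:~R / (a i n)%:~R : R) @[n --> \oo] --> +oo.

Lemma cvgryM (x y : nat -> R) : x n @[n --> \oo] --> +oo -> y n @[n --> \oo] --> +oo ->
  (x n * y n) @[n --> \oo] --> +oo.
Proof.
move=> xy yy; apply/cvgryPge => A; near=> n.
have x1 : 1 <= x n by near: n; exact: cvgry_ge.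
have yA : `|A| <= y n by near: n; exact: cvgry_ge.
apply: (le_trans (ler_norm A)); apply: (le_trans yA).
by apply: ler_peMl => //; exact: le_trans (normr_ge0 _) yA.
Unshelve. all: by end_near. Qed.

Lemma sequences_cvgry (i : 'I_k) : ((a i n)%:~R : R) @[n --> \oo] --> +oo.
Proof.
case: i => m; elim: m => [|m IH] mk.
  by rewrite (_ : Ordinal mk = Ordinal hk)//; exact: val_inj.
have mk' := ltnW mk; have am := IH mk'.
have := cvgryM (@hratio (Ordinal mk') (Ordinal mk) erefl) am.
apply: cvg_trans; apply: near_eq_cvg; near=> n.
rewrite divfK//; have : 0 < ((a (Ordinal mk') n)%:~R : R) by near: n; exact: cvgry_gt.
by move/gt_eqF/negbT.
Unshelve. all: by end_near. Qed.

Lemma sequences_neq0 (i : 'I_k) : \forall n \near \oo, a i n != 0.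
Proof.
near=> n; have : 0 < ((a i n)%:~R : R) by near: n; exact: cvgry_gt (sequences_cvgry i) _.
by move/gt_eqF/negbT; rewrite intr_eq0.
Unshelve. all: by end_near. Qed.

Lemma sequences_inv_cvg0 (i : 'I_k) : ((a i n)%:~R : R)^-1 @[n --> \oo] --> 0.
Proof.
apply/gtr0_cvgV0; last exact: sequences_cvgry.
by near=> n; near: n; exact: cvgry_gt (sequences_cvgry i) _.
Unshelve. all: by end_near. Qed.

(** The consecutive ratios multiply up to a j / a i, which therefore tends to
    infinity. *)
Lemma sequences_ratio_cvg0 (i j : 'I_k) : (i < j)%N ->
  ((a i n)%:~R / (a j n)%:~R : R) @[n --> \oo] --> 0.
Proof.
move=> ij.
have Hij : ((a j n)%:~R / (a i n)%:~R : R) @[n --> \oo] --> +oo.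
  case: j ij => m mk /=; elim: m mk => // m IH mk.
  rewrite ltnS leq_eqVlt => /orP[/eqP im|im]; first by apply: hratio; rewrite /= im.
  have mk' := ltnW mk.
  have := cvgryM (@hratio (Ordinal mk') (Ordinal mk) erefl) (IH mk' im).
  apply: cvg_trans; apply: near_eq_cvg; near=> n.
  rewrite mulrA divfK// intr_eq0; near: n; exact: sequences_neq0.
under eq_fun do rewrite -invf_div.
apply/gtr0_cvgV0 => //.
by near=> n; near: n; exact: cvgry_gt Hij _.
Unshelve. all: by end_near. Qed.

End growth.

(** * Relative joint mixing *)

Theorem proposition2p24 (R : realType) (k : nat) (hk : (1 <= k)%N)
    (T : 'I_k -> 'M[int]_2) (a : 'I_k -> nat -> int)
    (hdet : forall i, \det (T i) = 1)
    (hunip : forall i, unipotent R (T i))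
    (ha : ((a (Ordinal hk) n)%:~R : R) @[n --> \oo] --> +oo)
    (hratio : forall i j : 'I_k, j = i.+1 :> nat ->
       ((a j n)%:~R / (a i n)%:~R : R) @[n --> \oo] --> +oo) :
  relatively_jointly_mixing R k T a.
Proof.
move=> f h fL hL.
have [u Tu] := choice (fun i =>
  exists_unipotent_flow (hdet i) (unipotent_trace (hdet i) (hunip i)) R).
have [v Tuv] := choice Tu.
have parts (g : torus R -> R[i]) : in_Lp (haar R) +oo%E g -> exists x : bool -> torus R -> R,
    (forall b, bounded_measurable (x b)) /\
    {ae haar R, forall xi, complex.Re (g xi) = x true xi /\ complex.Im (g xi) = x false xi}.
  move=> /Loo_bounded_representative[_ [y [z [by_ bz gyz]]]].
  by exists (fun b => if b then y else z); split=> // -[].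
have mf i : cmeasurable (f i) by have [] := fL i.
have mh : cmeasurable h by have [] := hL.
have [x fx] := choice (fun i => parts (f i) (fL i)).
have [y [bdy hy]] := parts h hL.
have bx i b : bounded_measurable (x i b) by have [] := fx i.
have fE i : {ae haar R, forall xi, f i xi = \sum_(b : bool) unit_part b * (x i b xi)%:C%C}.
  have [_] := fx i; apply: filterS => xi [e1 e2].
  rewrite -(@complex_split _ (complex.Re (f i xi)) (complex.Im (f i xi)) (x i ^~ xi))//.
  by case: (f i xi).
have hE : {ae haar R, forall xi, h xi = \sum_(b : bool) unit_part b * (y b xi)%:C%C}.
  move: hy; apply: filterS => xi [e1 e2].
  rewrite -(@complex_split _ (complex.Re (h xi)) (complex.Im (h xi)) (y ^~ xi))//.
  by case: (h xi).
have PE i : {ae haar R, forall xi, invproj (T i) (f i) xi =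
    \sum_(b : bool) unit_part b * (flow_average (v i) (x i b) xi)%:C%C}.
  have [_ fi] := fx i.
  have := invproj_cflow_average (Tuv i) (mf i) (bx i true) (bx i false) fi.
  apply: filterS => xi ->.
  exact: (complex_split (x := fun b => flow_average (v i) (x i b) xi)).
have mP i : cmeasurable (invproj (T i) (f i)).
  have [_ fi] := fx i.
  have ex : exists g, is_invproj (T i) (f i) g.
    by exists (cflow_average (v i) (x i true) (x i false)); exact: is_invproj_cflow_average.
  by have [[]] := xgetPex (fun=> 0) ex.
pose J : finType := ({ffun 'I_k -> bool} * bool)%type.
pose C (j : J) : R[i] := (\prod_(i < k) unit_part (j.1 i)) * unit_part j.2.
pose w (z : 'I_k -> bool -> torus R -> R) (j : J) xi := (\prod_(i < k) z i (j.1 i) xi) * y j.2 xi.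
(* by multilinearity, both sides of the limit are one and the same linear
   combination of integrals of real functions, indexed by the parts chosen *)
have expand (g : 'I_k -> torus R -> R[i]) (z : 'I_k -> bool -> torus R -> R) :
    (forall i, cmeasurable (g i)) -> (forall i b, bounded_measurable (z i b)) ->
    (forall i, {ae haar R, forall xi, g i xi = \sum_(b : bool) unit_part b * (z i b xi)%:C%C}) ->
    cintegral (haar R) (fun xi => (\prod_(i < k) g i xi) * h xi) =
    Complex (\sum_(j : J) complex.Re (C j) * \int[haar R]_xi w z j xi)
            (\sum_(j : J) complex.Im (C j) * \int[haar R]_xi w z j xi).
  move=> mg bz gz.
  have bw j : bounded_measurable (w z j).
    by apply: bounded_measurableM => //; exact: bounded_measurable_prod.
  rewrite -cintegral_sum//; apply: cintegral_ae_eq.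
  - by apply: cmeasurableM => //; exact: cmeasurable_prod.
  - exact: cmeasurable_sum.
  - have gz' : {ae haar R, forall xi, forall i, g i xi =
        \sum_(b : bool) unit_part b * (z i b xi)%:C%C} by exact: filter_forall.
    apply: filterS2 gz' hE => xi gxi ->.
    under eq_bigr do rewrite gxi.
    exact: (multilinear_expansion (fun i b => z i b xi) (y ^~ xi)).
have actE n : cintegral (haar R) (fun xi => (\prod_(i < k) f i (torus_act (T i ^ a i n) xi)) * h xi) =
    Complex (\sum_(j : J) complex.Re (C j) *
       \int[haar R]_xi w (fun i b => x i b \o torus_act (T i ^ a i n)) j xi)
     (\sum_(j : J) complex.Im (C j) *
       \int[haar R]_xi w (fun i b => x i b \o torus_act (T i ^ a i n)) j xi).
  apply: (expand (fun i => f i \o torus_act (T i ^ a i n))).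
  - move=> i; have [m1 m2] := mf i; have mA := @measurable_torus_act R (T i ^ a i n).
    by split; [exact: measurableT_comp m1 mA|exact: measurableT_comp m2 mA].
  - by move=> i b; exact: bounded_measurable_act.
  - move=> i; have [_ /(_ (a i n)) detT _ _] := Tuv i.
    exact: (ae_mp (@measure_preserving_torus_act R _ detT) (fE i)).
under eq_fun do rewrite actE.
rewrite (expand _ (fun i b => flow_average (v i) (x i b)) mP _ PE); last first.
  by move=> i b; exact: bounded_measurable_flow_average.
have lim j : \int[haar R]_xi w (fun i b => x i b \o torus_act (T i ^ a i n)) j xi
    @[n --> \oo] --> \int[haar R]_xi w (fun i b => flow_average (v i) (x i b)) j xi.
  apply: (@real_mixing R k T u v a (fun i => x i (j.1 i)) (y j.2) Tuv) => //.
  - exact: sequences_inv_cvg0 ha hratio.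
  - exact: sequences_neq0 ha hratio.
  - exact: sequences_ratio_cvg0 ha hratio.
apply: cvg_complex; apply: cvg_big => [|j _].
- exact: add_continuous.
- by apply: cvgM => //; exact: cvg_cst.
- exact: add_continuous.
- by apply: cvgM => //; exact: cvg_cst.
Qed.
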